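(* Let $\psi:\mathbb{R}^d\to(-\infty,\infty]$ be proper, closed, convex, bounded from below with $\int e^{-\psi}<\infty$; fix $\lambda>0$ and let $\pi^\lambda(x)\propto e^{-\psi^\lambda(x)}$. Assume $$\limsup_{\|x\|\to\infty}\frac{\|\mathrm{prox}^\lambda_\psi(x)\|}{\|x\|}=l<1.$$ Consider the MALA chain targeting $\pi^\lambda$ with step size $h>0$: from $x$, propose $y\sim q_M(x,\cdot)$, the density of $N(c(x),h\mathbb I_d)$ with $c(x)=x-\frac h2\nabla\psi^\lambda(x)$, and accept with probability $\min\{1,\pi^\lambda(y)q_M(y,x)/(\pi^\lambda(x)q_M(x,y))\}$. Let $A(x)=\{y:\pi^\lambda(y)q_M(y,x)\ge \pi^\lambda(x)q_M(x,y)\}$ and $I(x)=\{y:\|y\|\le\|x\|\}$, and assume $A(\cdot)$ converges inwards in $q_M$, i.e. $\lim_{\|x\|\to\infty}\int_{A(x)\,\Delta\, I(x)}q_M(x,y)\,dy=0$, where $\Delta$ is symmetric difference. Then if $h\le 2\lambda$, the $\pi^\lambda$-MALA chain is geometrically ergodic.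
   Context: Moreau-Yosida envelope: $\psi^\lambda(x)=\inf_y\{\psi(y)+\frac1{2\lambda}\|y-x\|^2\}$; proximal mapping: $\mathrm{prox}^\lambda_\psi(x)=\arg\min_y\{\psi(y)+\frac1{2\lambda}\|y-x\|^2\}$ (unique). $\psi^\lambda$ is continuously differentiable with $\nabla\psi^\lambda(x)=\frac1\lambda(x-\mathrm{prox}^\lambda_\psi(x))$. *)

(* Defs.v *)
From HB Require Import structures.
From mathcomp Require Import all_boot all_order all_algebra.
From mathcomp Require Import all_classical all_reals all_analysis.
Set Implicit Arguments. Unset Strict Implicit. Unset Printing Implicit Defensive.
Import Order.TTheory GRing.Theory Num.Theory.
Import numFieldNormedType.Exports.
Local Open Scope classical_set_scope.
Local Open Scope ring_scope.

Section MALA.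
Variable R : realType.

(* Euclidean norm on R^d (the library norm on matrices is the sup norm). *)
Definition enorm d (v : 'rV[R]_d) : R := Num.sqrt (\sum_(i < d) v ord0 i ^+ 2).

Definition vcons n (t : R) (v : 'rV[R]_n) : 'rV[R]_n.+1 :=
  \row_(i < n.+1) (if unlift ord0 i is Some j then v ord0 j else t).

(* Lebesgue integral over R^n of a nonnegative function, written as the
   iterated one-dimensional Lebesgue integral (Tonelli). *)
Fixpoint intRd (n : nat) : ('rV[R]_n -> \bar R) -> \bar R :=
  match n with
  | 0 => fun f => f 0
  | n'.+1 => fun f =>
      (\int[@lebesgue_measure R]_(t in [set: R]) @intRd n' (fun v => f (vcons t v)))%E
  end.

Definition borelRd d (B : set 'rV[R]_d) : Prop :=
  smallest (sigma_algebra [set: 'rV[R]_d]) (@open 'rV[R]_d) B.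

Definition proper_fun d (psi : 'rV[R]_d -> \bar R) : Prop :=
  (exists x, (psi x < +oo)%E) /\ (forall x, (-oo < psi x)%E).

Definition lsc d (psi : 'rV[R]_d -> \bar R) : Prop :=
  forall x (a : R), (a%:E < psi x)%E -> \forall y \near x, (a%:E < psi y)%E.

Definition convex_fun d (psi : 'rV[R]_d -> \bar R) : Prop :=
  forall x y (t : R), 0 <= t <= 1 ->
    (psi (t *: x + (1 - t) *: y)%R <= t%:E * psi x + (1 - t)%R%:E * psi y)%E.

Definition bounded_below d (psi : 'rV[R]_d -> \bar R) : Prop :=
  exists m : R, forall x, (m%:E <= psi x)%E.

Definition moreau d (psi : 'rV[R]_d -> \bar R) (lam : R) (x : 'rV[R]_d) : \bar R :=
  ereal_inf [set (psi y + ((enorm (y - x)) ^+ 2 / (2 * lam))%R%:E)%E | y in [set: 'rV[R]_d]].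

(* the (unique) minimiser *)
Definition prox d (psi : 'rV[R]_d -> \bar R) (lam : R) (x : 'rV[R]_d) : 'rV[R]_d :=
  xget 0 [set y | (psi y + ((enorm (y - x)) ^+ 2 / (2 * lam))%R%:E)%E = moreau psi lam x].

(* real-valued envelope (it is finite everywhere for proper psi bounded below) *)
Definition moreauR d (psi : 'rV[R]_d -> \bar R) (lam : R) (x : 'rV[R]_d) : R :=
  fine (moreau psi lam x).

Definition grad d (f : 'rV[R]_d -> R) (x : 'rV[R]_d) : 'rV[R]_d :=
  \row_(i < d) ('D_(delta_mx ord0 i) f x).

Definition Zlam d (psi : 'rV[R]_d -> \bar R) (lam : R) : R :=
  fine (intRd (fun x => (expR (- moreauR psi lam x))%:E)).

Definition pi_dens d (psi : 'rV[R]_d -> \bar R) (lam : R) (x : 'rV[R]_d) : R :=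
  expR (- moreauR psi lam x) / Zlam psi lam.

Definition pi_meas d (psi : 'rV[R]_d -> \bar R) (lam : R) (B : set 'rV[R]_d) : \bar R :=
  intRd (fun x => (\1_B x * pi_dens psi lam x)%:E).

Definition mala_mean d (psi : 'rV[R]_d -> \bar R) (lam h : R) (x : 'rV[R]_d) : 'rV[R]_d :=
  x - (h / 2) *: grad (moreauR psi lam) x.

Definition qM d (psi : 'rV[R]_d -> \bar R) (lam h : R) (x y : 'rV[R]_d) : R :=
  (Num.sqrt (2 * pi * h))^-1 ^+ d *
  expR (- (enorm (y - mala_mean psi lam h x)) ^+ 2 / (2 * h)).

Definition accept d (psi : 'rV[R]_d -> \bar R) (lam h : R) (x y : 'rV[R]_d) : R :=
  Num.min 1 ((pi_dens psi lam y * qM psi lam h y x) /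
             (pi_dens psi lam x * qM psi lam h x y)).

Definition mala_op d (psi : 'rV[R]_d -> \bar R) (lam h : R)
    (f : 'rV[R]_d -> \bar R) (x : 'rV[R]_d) : \bar R :=
  (intRd (fun y => (accept psi lam h x y * qM psi lam h x y)%R%:E * f y)
   + (1 - intRd (fun y => (accept psi lam h x y * qM psi lam h x y)%R%:E)) * f x)%E.

Definition mala_kernel_n d (psi : 'rV[R]_d -> \bar R) (lam h : R) (n : nat)
    (x : 'rV[R]_d) (B : set 'rV[R]_d) : \bar R :=
  iter n (mala_op psi lam h) (fun y => (\1_B y : R)%:E) x.

(* geometric ergodicity (Roberts-Tweedie): there are rho < 1 and a finite
   M(x) with ||P^n(x,.) - pi||_TV <= M(x) rho^n for pi-a.e. x. *)
Definition geometrically_ergodic d (psi : 'rV[R]_d -> \bar R) (lam h : R) : Prop :=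
  exists (rho : R) (M : 'rV[R]_d -> R) (N : set 'rV[R]_d),
    0 <= rho < 1 /\ borelRd N /\ pi_meas psi lam N = 0%E /\
    forall x, ~ N x -> forall (n : nat) (B : set 'rV[R]_d), borelRd B ->
      (`| mala_kernel_n psi lam h n x B - pi_meas psi lam B | <= (M x * rho ^+ n)%R%:E)%E.

Definition limsup_norm d (f : 'rV[R]_d -> R) : \bar R :=
  ereal_inf [set ereal_sup [set (f x)%:E | x in [set x | r <= enorm x]] | r in [set: R]].

Definition Aset d (psi : 'rV[R]_d -> \bar R) (lam h : R) (x : 'rV[R]_d) : set 'rV[R]_d :=
  [set y | pi_dens psi lam x * qM psi lam h x y <= pi_dens psi lam y * qM psi lam h y x].

Definition Iset d (x : 'rV[R]_d) : set 'rV[R]_d := [set y | enorm y <= enorm x].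

Definition symdiff T (A B : set T) : set T := (A `\` B) `|` (B `\` A).

Definition converges_inwards d (psi : 'rV[R]_d -> \bar R) (lam h : R) : Prop :=
  forall eps : R, 0 < eps -> exists r : R, forall x, r <= enorm x ->
    (intRd (fun y => (\1_(symdiff (Aset psi lam h x) (Iset x)) y
                      * qM psi lam h x y)%:E) <= eps%:E)%E.

End MALA.

(* Main.v *)
Require Import Defs.
From HB Require Import structures.
From mathcomp Require Import all_boot all_order all_algebra.
From mathcomp Require Import all_classical all_reals all_analysis.
From mathcomp Require Import ring lra measurable_realfun.
Import Order.TTheory GRing.Theory Num.Theory.
Import numFieldNormedType.Exports.
Local Open Scope classical_set_scope.
Local Open Scope ring_scope.

(** With [p = prox x], the gradient of the envelope is [(x - p) / lam], so the
proposal mean is the convex combination [(1 - t) x + t p] with [t = h / (2 lam)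
<= 1]; since [|p| <= k |x|] with [k < 1] far out, the mean contracts [|x|^2] by a
factor [< 1]. An acceptance rate below 1 can only hurt the Lyapunov function
[V x = |x|^2] on [A(x) \Delta I(x)], whose proposal mass vanishes at infinity, so
[P V <= g V + K] with [g < 1]. The kernel is bounded below by a multiple of a
Gaussian density uniformly on sublevel sets of [V]. The Hairer--Mattingly form of
Harris' theorem then contracts the oscillation of [P^n f] weighted by
[2 + b (V x + V y)], and integrating against the invariant density, for which [V]
is integrable because the envelope grows quadratically, gives the rate. *)

Set Implicit Arguments. Unset Strict Implicit. Unset Printing Implicit Defensive.

(** * Lebesgue integration on row vectors *)

(** The chain is given by iterated one-dimensional integrals, for which linearity and the exchange
    of two integrations over [R^d] are not immediate; a single sigma-finite measure on the Borel
    sets replaces them, and Tonelli then yields invariance from detailed balance. Rejection puts an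
    atom at the current point, so kernels started at different points can share mass only through
    their accepted densities. These are bounded below on [V <= L] for every [L], which fixes the
    order of choices: the drift constants [g] and [K] come before [L], since Harris' theorem
    requires [2 K < (1 - g) L]. The gradient is encoded by directional derivatives, so its formula
    has to be proved: a minimiser is shown to exist, its optimality is a subgradient inequality,
    this makes [prox] nonexpansive, and nonexpansiveness gives a two-sided quadratic expansion of
    the envelope. Squared norms are used throughout, so that the estimates reduce to Young's
    inequality and real arithmetic. *)

Notation rowB R n := (g_sigma_algebraType (@open 'rV[R]_n)).

Lemma measurable_ler_set d (T : measurableType d) (R : realType) (f g : T -> R) :
  measurable_fun setT f -> measurable_fun setT g ->
  measurable [set x | f x <= g x].
Proof.
move=> mf mg; rewrite -[X in measurable X]setTI.
exact: (measurable_fun_ler mf mg measurableT (Y := [set true])).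
Qed.

Lemma measurable_ltr_set d (T : measurableType d) (R : realType) (f g : T -> R) :
  measurable_fun setT f -> measurable_fun setT g ->
  measurable [set x | f x < g x].
Proof.
move=> mf mg; rewrite -[X in measurable X]setTI.
exact: (measurable_fun_ltr mf mg measurableT (Y := [set true])).
Qed.

Section SigmaFiniteCopy.
Context d (T : measurableType d) (R : realType) (nu : {measure set T -> \bar R}).
Hypothesis snu : sigma_finite setT nu.

Let sf_nu : set T -> \bar R := nu.

HB.instance Definition _ := Measure.copy sf_nu nu.
HB.instance Definition _ := Measure_isSigmaFinite.Build _ _ _ sf_nu snu.

(** Sigma-finiteness proved as a proposition is turned into the bundled structure, declared on a
    local copy of [nu]. The measures on row vectors are built as pushforwards and reach the bundled
    type in this way. *)
Lemma sigma_finite_measureP :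
  exists nu' : {sigma_finite_measure set T -> \bar R}, nu' = nu :> (set T -> \bar R).
Proof. by exists sf_nu. Qed.

End SigmaFiniteCopy.

Section RowBorel.
Variable R : realType.

Lemma open_rowB_measurable n (U : set 'rV[R]_n) :
  open U -> measurable (U : set (rowB R n)).
Proof. by move=> oU; exact: sub_sigma_algebra. Qed.

Lemma continuous_rowB_measurable n (f : 'rV[R]_n -> R) :
  continuous f -> measurable_fun setT (f : rowB R n -> R).
Proof.
move=> /continuousP cf; apply: (measurability _ (RGenOpens.measurableE R)).
move=> _ [_ [a [b ->] <-]]; rewrite setTI; apply: open_rowB_measurable.
exact/cf/interval_open.
Qed.

Lemma coord_measurable n (i : 'I_n) :
  measurable_fun setT (fun v : rowB R n => v ord0 i : R).
Proof. by apply: continuous_rowB_measurable; exact: coord_continuous. Qed.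

(** Sup-norm balls with rational centre and radius [1 / (k + 1)]: a countable base of the
    topology. *)
Definition rat_box n (c : 'rV[rat]_n) (k : nat) : set 'rV[R]_n :=
  [set v | forall i, `|v ord0 i - ratr (c ord0 i)| < k.+1%:R^-1].

Lemma rat_box_open n (U : set 'rV[R]_n) : open U ->
  U = \bigcup_(p in [set p : 'rV[rat]_n * nat | rat_box p.1 p.2 `<=` U])
        rat_box p.1 p.2.
Proof.
move=> oU; rewrite eqEsubset; split=> [v Uv|v [p pU]]; last exact: pU.
have /nbhs_ballP[e /= e0 eU] : nbhs v U by exact: open_nbhs_nbhs.
(* The radius is below [e / 2]: the rational centre is that close to [v], and every point of the box
   that close to the centre, so the box stays in the [e]-ball. *)
pose k := Num.truncn (2 / e).
have k2 : k.+1%:R^-1 < e / 2.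
  rewrite invf_plt ?posrE ?divr_gt0// invf_div.
  by have := truncnS_gt (2 / e).
have k0 : 0 < k.+1%:R^-1 :> R by rewrite invr_gt0.
have [r rE] : exists r, r = k.+1%:R^-1 :> R by eexists.
rewrite -rE in k2 k0.
have ex i : exists q : rat, `|v ord0 i - ratr q| < r.
  have /rat_in_itvoo[q] : v ord0 i - r < v ord0 i + r by lra.
  rewrite in_itv/= => /andP[q1 q2]; exists q.
  by rewrite ltr_norml; apply/andP; split; lra.
have [g gP] := choice ex.
exists (\row_i g i, k); rewrite /rat_box/= -?rE; last by move=> i; rewrite mxE.
move=> w /= wP; apply: eU; split=> // i j; rewrite ord1 /ball/=.
have := wP j; have := gP j; rewrite mxE => h1 h2.
rewrite (le_lt_trans (ler_distD (ratr (g j)) _ _))//.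
rewrite (distrC (ratr _)); lra.
Qed.

(** The Borel sets are generated by coordinates: an open set is a countable union of rational boxes,
    and each box is a finite intersection of conditions on one coordinate. *)
Lemma measurable_row_fun d (T : measurableType d) n (f : T -> rowB R n) :
  (forall i, measurable_fun setT (fun x => f x ord0 i : R)) ->
  measurable_fun setT f.
Proof.
move=> mf; apply: (@measurability _ _ _ (rowB R n) setT f (@open 'rV[R]_n) erefl).
move=> _ [U oU <-].
rewrite setTI [U](rat_box_open oU) preimage_bigcup.
rewrite bigcup_mkcond; apply: countable_bigcupT_measurable => [|p].
  exact: countableP.
case: ifP => // _.
rewrite (_ : _ @^-1` _ = \bigcap_(i in [set: 'I_n])
   [set x | `|f x ord0 i - ratr (p.1 ord0 i)| < p.2.+1%:R^-1]); last first.
  by apply/seteqP; split=> x /= h i; [move=> _|]; apply: h.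
apply: fin_bigcap_measurable => // i _.
have mi : measurable_fun setT (fun x => `|f x ord0 i - ratr (p.1 ord0 i)|).
  by apply: measurableT_comp => //; exact: measurable_funB.
exact: (measurable_ltr_set mi (measurable_cst _)).
Qed.

Lemma measurable_vcons n :
  measurable_fun setT
    (fun p : measurableTypeR R * rowB R n => vcons p.1 p.2 : rowB R n.+1).
Proof.
apply: measurable_row_fun => i.
rewrite (_ : (fun x => _) = fun p : measurableTypeR R * rowB R n =>
    if unlift ord0 i is Some j then p.2 ord0 j else p.1); last first.
  by apply/funext => p; rewrite mxE.
case: (unlift ord0 i) => [j|]; last exact: measurable_fst.
by apply: (measurableT_comp (coord_measurable j)); exact: measurable_snd.
Qed.

Definition vtail n (v : 'rV[R]_n.+1) : 'rV[R]_n := \row_i v ord0 (lift ord0 i).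

Lemma vtail_vcons n t (v : 'rV[R]_n) : vtail (vcons t v) = v.
Proof. by apply/rowP => i; rewrite !mxE liftK. Qed.

Lemma vhead_vcons n t (v : 'rV[R]_n) : vcons t v ord0 ord0 = t.
Proof. by rewrite mxE unlift_none. Qed.

Lemma vcons_lift n t (v : 'rV[R]_n) i : vcons t v ord0 (lift ord0 i) = v ord0 i.
Proof. by rewrite mxE liftK. Qed.

(** By induction: a Dirac mass in dimension 0, then the image under [vcons] of the product of
    Lebesgue measure with the previous measure, where Tonelli recovers the iterated integral.
    Sigma-finiteness is part of the induction because the product and Tonelli rely on it. *)
Lemma intRd_measure n : exists mu : {sigma_finite_measure set (rowB R n) -> \bar R},
  forall f : rowB R n -> \bar R, measurable_fun setT f -> (forall x, 0 <= f x)%E ->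
    intRd f = (\int[mu]_x f x)%E.
Proof.
elim: n => [|n [mu IH]].
  exists (@dirac _ (rowB R 0) 0 R : {sigma_finite_measure set _ -> \bar R}).
  by move=> f mf f0 /=; rewrite integral_dirac// diracT mul1e.
pose vc (p : measurableTypeR R * rowB R n) := vcons p.1 p.2 : rowB R n.+1.
have mvc : measurable_fun setT vc by exact: measurable_vcons.
pose L : {sigma_finite_measure set (measurableTypeR R) -> \bar R} :=
  @lebesgue_measure R.
have [nu nuE] : exists nu : {measure set (rowB R n.+1) -> \bar R},
    nu = pushforward (L \x mu)%E vc :> (set _ -> _).
  by unshelve eexists (pushforward (L \x mu)%E vc : {measure set (rowB R n.+1) -> \bar R}).
have snu : sigma_finite setT nu.
  have /sigma_finiteP[F [FT ndF Foo]] := sigma_finiteT L.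
  have /sigma_finiteP[G [GT ndG Goo]] := sigma_finiteT mu.
  (* The inverse of [vcons]; it transports the exhaustion by the products [F k] times [G k].
     Monotonicity of both sequences provides the common index [maxn i j] below. *)
  pose un (v : rowB R n.+1) : measurableTypeR R * rowB R n :=
    (v ord0 ord0, vtail v).
  have mun : measurable_fun setT un.
    apply: measurable_fun_pair; first exact: coord_measurable.
    apply: measurable_row_fun => i.
    rewrite (_ : (fun x => _) = fun x : rowB R n.+1 => x ord0 (lift ord0 i)).
      exact: coord_measurable.
    by apply/funext => x; rewrite mxE.
  exists (fun k => un @^-1` (F k `*` G k)).
    apply/esym/seteqP; split=> // v _ /=.
    have [i _ Fi] : (\bigcup_i F i) (v ord0 ord0) by rewrite -FT.
    have [j _ Gj] : (\bigcup_i G i) (vtail v) by rewrite -GT.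
    exists (maxn i j) => //; split => /=.
    - by move: Fi; exact/subsetPset/ndF/leq_maxl.
    - by move: Gj; exact/subsetPset/ndG/leq_maxr.
  move=> k; have [mF ooF] := Foo k; have [mG ooG] := Goo k.
  have mFG : measurable (F k `*` G k) by exact: measurableX.
  split; first by rewrite -[X in measurable X]setTI; exact: mun.
  rewrite nuE/= /pushforward (_ : _ @^-1` _ = F k `*` G k); last first.
    by apply/seteqP; split=> -[a b] /=; rewrite /un /vc/= vtail_vcons vhead_vcons.
  by rewrite product_measure1E// lte_mul_pinfty// ge0_fin_numE.
have [nu' nu'E] := sigma_finite_measureP snu.
exists nu' => f mf f0.
rewrite nu'E nuE.
rewrite [RHS](ge0_integral_pushforward mvc (L \x mu)%E)//=; last first.
rewrite preimage_setT fubini_tonelli1//=; last first.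
  by apply: measurableT_comp.
apply: eq_integral => t _; rewrite IH//.
exact: (measurableT_comp mf (measurableT_comp mvc (pair1_measurable t))).
Qed.

End RowBorel.

(** * Harris' theorem for a reversible kernel with rejection *)

(** The arithmetic of the Harris contraction, with [S] standing for [V x + V y]. For large [S] the
    drift wins over the constant [2 b K]; for small [S] the gain [2 eps] from the common mass pays
    for it. *)
Lemma contraction_rate (R : realType) (g K L eps : R) :
  0 <= g < 1 -> 0 <= K -> 2 * K < (1 - g) * L -> 0 < eps <= 1 ->
  exists b r, [/\ 0 < b, 0 <= r < 1,
    forall S, L <= S -> 2 + 2 * b * K + b * g * S <= r * (2 + b * S) &
    forall S, 0 <= S -> 2 - 2 * eps + 2 * b * K + b * g * S <= r * (2 + b * S)].
Proof.
move=> /andP[g0 g1] K0 KL /andP[e0 e1].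
(* With this [b], the term [2 b K] costs at most half of the gain [2 eps]; the [+ 1] covers
   [K = 0]. *)
pose b := eps / (2 * (K + 1)).
have b0 : 0 < b by rewrite divr_gt0// mulr_gt0//; lra.
have bK : 2 * b * K <= eps.
  by rewrite /b mulrA mulrAC ler_pdivrMr; nra.
have L0 : 0 < L by nra.
have D0 : 0 < 2 + b * L by nra.
(* The exact ratio at [S = L], below 1 because [2 K < (1 - g) L]. Beyond [L] the left side grows
   with slope [b g], at most the slope [b r] of the right side. *)
pose r1 := (2 + 2 * b * K + b * g * L) / (2 + b * L).
pose r := Num.max (Num.max g (1 - eps / 2)) r1.
have gr : g <= r by rewrite /r !le_max lexx.
have er : 1 - eps / 2 <= r by rewrite /r !le_max lexx orbT.
have r1r : r1 <= r by rewrite /r le_max lexx orbT.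
have r1D : 2 + 2 * b * K + b * g * L = r1 * (2 + b * L) by rewrite /r1 divfK ?gt_eqF.
exists b, r; split => //.
- rewrite (le_trans g0 gr)/= /r !gt_max g1 /= ltrBlDr ltrDl divr_gt0//=.
  by rewrite /r1 ltr_pdivrMr// mul1r; nra.
- move=> S LS; have : r1 * (2 + b * L) <= r * (2 + b * L) by rewrite ler_pM2r.
  have : g * (b * (S - L)) <= r * (b * (S - L)).
    by rewrite ler_wpM2r// mulr_ge0 ?subr_ge0// ltW.
  rewrite -r1D; nra.
- move=> S S0; have : g * (b * S) <= r * (b * S).
    by rewrite ler_wpM2r// mulr_ge0 ?subr_ge0// ltW.
  nra.
Qed.

Section Harris.
Context d (T : measurableType d) (R : realType)
  (mu : {sigma_finite_measure set T -> \bar R}).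
Variables (a : T -> T -> R) (p V w : T -> R).
Hypothesis ma : measurable_fun setT (fun z : T * T => a z.1 z.2).
Hypothesis a0 : forall x y, 0 <= a x y.
Hypothesis a1 : forall x, (\int[mu]_y (a x y)%:E <= 1)%E.

Definition acc_mass x : R := \int[mu]_y a x y.

(** A kernel with density [a x], the accepted proposals, and an atom at [x] carrying the mass that
    [a x] lacks. *)
Definition mh_op (f : T -> R) x : R :=
  \int[mu]_y (a x y * f y) + (1 - acc_mass x) * f x.

Lemma measurable_kernel x : measurable_fun setT (a x).
Proof.
rewrite (_ : a x = (fun z => a z.1 z.2) \o pair x)//.
exact: (measurableT_comp ma (pair1_measurable x)).
Qed.

Lemma ge0_integrable (f : T -> R) : measurable_fun setT f ->
  (forall x, 0 <= f x) -> (\int[mu]_x (f x)%:E < +oo)%E ->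
  mu.-integrable setT (EFin \o f).
Proof.
move=> mf f0 foo; apply/integrableP; split; first exact/measurable_EFinP.
by under eq_integral => x _ do rewrite /= ger0_norm//.
Qed.

Lemma bounded_integrable (f g : T -> R) : measurable_fun setT f ->
  (forall x, `|f x| <= g x) -> mu.-integrable setT (EFin \o g) ->
  mu.-integrable setT (EFin \o f).
Proof.
move=> mf fg; apply: le_integrable => //; first exact/measurable_EFinP.
by move=> x _ /=; rewrite lee_fin (le_trans (fg x))// ler_norm.
Qed.

Lemma integrable_subr (f g : T -> R) :
  mu.-integrable setT (EFin \o f) -> mu.-integrable setT (EFin \o g) ->
  mu.-integrable setT (EFin \o (fun x => f x - g x)).
Proof. by move=> intf intg; exact: (integrableB measurableT intf intg). Qed.

Lemma integrable_addr (f g : T -> R) :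
  mu.-integrable setT (EFin \o f) -> mu.-integrable setT (EFin \o g) ->
  mu.-integrable setT (EFin \o (fun x => f x + g x)).
Proof. by move=> intf intg; exact: (integrableD measurableT intf intg). Qed.

Lemma integrable_scale (k : R) (f : T -> R) :
  mu.-integrable setT (EFin \o f) ->
  mu.-integrable setT (EFin \o (fun x => k * f x)).
Proof. by move=> intf; exact: (integrableZl measurableT k intf). Qed.

Lemma integrable_kernel x : mu.-integrable setT (EFin \o a x).
Proof.
by apply: ge0_integrable;
  [exact: measurable_kernel|by []|rewrite (le_lt_trans (a1 x))// ltry].
Qed.

Lemma acc_massE x : (acc_mass x)%:E = (\int[mu]_y (a x y)%:E)%E.
Proof. by rewrite fineK//; exact: (integrable_fin_num _ (integrable_kernel x)). Qed.

Lemma acc_mass01 x : 0 <= acc_mass x <= 1.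
Proof. by rewrite Rintegral_ge0//= -lee_fin acc_massE. Qed.

Lemma integrable_kernelM x (f : T -> R) : measurable_fun setT f ->
  (forall y, `|f y| <= 1) ->
  mu.-integrable setT (EFin \o (fun y => a x y * f y)).
Proof.
move=> mf f1; apply: (bounded_integrable _ _ (integrable_kernel x)).
  by apply: measurable_funM => //; exact: measurable_kernel.
by move=> y; rewrite normrM ger0_norm// ler_piMr.
Qed.

Lemma int_kernelME x (f : T -> R) : measurable_fun setT f ->
  (forall y, 0 <= f y <= 1) ->
  (\int[mu]_y (a x y * f y))%:E = (\int[mu]_y (a x y * f y)%:E)%E.
Proof.
move=> mf f1; rewrite fineK//; apply: integrable_fin_num => //.
by apply: integrable_kernelM => // y; have /andP[? ?] := f1 y; rewrite ger0_norm.
Qed.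

Lemma measurable_int_kernelM (f : T -> R) : measurable_fun setT f ->
  (forall y, 0 <= f y) ->
  measurable_fun setT (fun x => \int[mu]_y (a x y * f y)).
Proof.
move=> mf f0; apply: measurableT_comp => //.
pose F (z : T * T) := (a z.1 z.2 * f z.2)%:E.
have mF : measurable_fun setT F.
  apply/measurable_EFinP; apply: measurable_funM => //.
  exact: measurableT_comp.
apply: (measurable_fun_fubini_tonelli_F F mF) => z.
by rewrite lee_fin mulr_ge0.
Qed.

Lemma measurable_acc_mass : measurable_fun setT acc_mass.
Proof.
rewrite (_ : acc_mass = fun x => \int[mu]_y (a x y * 1)).
  exact: measurable_int_kernelM.
by apply/funext => x; apply: eq_Rintegral => y _; rewrite mulr1.
Qed.

Lemma measurable_mh_op (f : T -> R) : measurable_fun setT f ->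
  (forall y, 0 <= f y) -> measurable_fun setT (mh_op f).
Proof.
move=> mf f0; apply: measurable_funD; first exact: measurable_int_kernelM.
apply: measurable_funM => //; apply: measurable_funB => //.
exact: measurable_acc_mass.
Qed.

Lemma mh_op01 (f : T -> R) : measurable_fun setT f -> (forall y, 0 <= f y <= 1) ->
  forall x, 0 <= mh_op f x <= 1.
Proof.
move=> mf f01 x; have /andP[A0 A1] := acc_mass01 x.
have /andP[f0 f1] := f01 x.
have I0 : 0 <= \int[mu]_y (a x y * f y).
  by apply: Rintegral_ge0 => y _; rewrite mulr_ge0//; case/andP: (f01 y).
have I1 : \int[mu]_y (a x y * f y) <= acc_mass x.
  apply: le_Rintegral => //.
  - by apply: integrable_kernelM => // y; have /andP[? ?] := f01 y; rewrite ger0_norm.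
  - exact: integrable_kernel.
  - by move=> y _; rewrite ler_piMr//; case/andP: (f01 y).
by rewrite /mh_op; apply/andP; split; nra.
Qed.

Lemma iter_mh_op (f : T -> R) n :
  measurable_fun setT f -> (forall y, 0 <= f y <= 1) ->
  measurable_fun setT (iter n mh_op f) /\ forall y, 0 <= iter n mh_op f y <= 1.
Proof.
move=> mf f01; elim: n => [//|n [mi i01]] /=; split; last exact: mh_op01.
by apply: measurable_mh_op => // y; case/andP: (i01 y).
Qed.

(** * Detailed balance and invariance *)

Hypothesis mp : measurable_fun setT p.
Hypothesis p0 : forall x, 0 <= p x.
Hypothesis p1 : (\int[mu]_x (p x)%:E = 1)%E.
Hypothesis rev : forall x y, p x * a x y = p y * a y x.

Lemma integrable_density : mu.-integrable setT (EFin \o p).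
Proof. by apply: ge0_integrable; rewrite // p1 ltry. Qed.

Lemma integrable_densityM (f : T -> R) : measurable_fun setT f ->
  (forall y, `|f y| <= 1) ->
  mu.-integrable setT (EFin \o (fun y => p y * f y)).
Proof.
move=> mf f1; apply: (bounded_integrable _ _ integrable_density).
  exact: measurable_funM.
by move=> y; rewrite normrM ger0_norm// ler_piMr.
Qed.

(** By detailed balance the accepted flow into [y], weighted by [f y], equals the accepted flow out
    of [y], which is exactly what the rejection term subtracts. *)
Lemma mh_op_invariant (f : T -> R) :
  measurable_fun setT f -> (forall y, 0 <= f y <= 1) ->
  \int[mu]_x (p x * mh_op f x) = \int[mu]_x (p x * f x).
Proof.
move=> mf f01.
have f0 y : 0 <= f y by case/andP: (f01 y).
have fn y : `|f y| <= 1 by rewrite ger0_norm//; case/andP: (f01 y).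
have Af01 y : 0 <= acc_mass y * f y <= 1.
  have /andP[? ?] := acc_mass01 y; have /andP[? ?] := f01 y.
  by apply/andP; split; nra.
have mAf : measurable_fun setT (fun y => acc_mass y * f y).
  by apply: measurable_funM => //; exact: measurable_acc_mass.
have Ia01 x : 0 <= \int[mu]_y (a x y * f y) <= 1.
  have := mh_op01 mf f01 x; rewrite /mh_op.
  have /andP[? ?] := acc_mass01 x; have /andP[? ?] := f01 x.
  have : 0 <= \int[mu]_y (a x y * f y).
    by apply: Rintegral_ge0 => y _; rewrite mulr_ge0.
  by move=> -> /=; nra.
have mIa := measurable_int_kernelM mf f0.
have nb (h : T -> R) : (forall y, 0 <= h y <= 1) -> forall y, `|h y| <= 1.
  by move=> h01 y; case/andP: (h01 y) => ? ?; rewrite ger0_norm.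
rewrite (_ : \int[mu]_x (p x * mh_op f x) =
  \int[mu]_x (p x * \int[mu]_y (a x y * f y) +
              (p x * f x - p x * (acc_mass x * f x)))); last first.
  by apply: eq_Rintegral => x _; rewrite /mh_op; ring.
rewrite RintegralD//; first last.
- by apply: integrable_subr => //; apply: integrable_densityM => //; exact: nb.
- by apply: integrable_densityM => //; exact: nb.
rewrite RintegralB//; [|by apply: integrable_densityM => //; exact: nb..].
(* Tonelli swaps the integrals and [rev] turns [p x * a x y] into [p y * a y x], whose integral over
   [x] is [p y * acc_mass y]. *)
suff -> : \int[mu]_x (p x * \int[mu]_y (a x y * f y)) =
          \int[mu]_x (p x * (acc_mass x * f x)) by ring.
pose F (z : T * T) := (p z.1 * (a z.1 z.2 * f z.2))%:E.
have mF : measurable_fun setT F.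
  apply/measurable_EFinP; apply: measurable_funM.
    exact: measurableT_comp.
  by apply: measurable_funM => //; exact: measurableT_comp.
have F0 z : (0 <= F z)%E by rewrite lee_fin !mulr_ge0.
congr fine.
transitivity (\int[mu]_x \int[mu]_y F (x, y))%E.
  apply: eq_integral => x _; rewrite EFinM int_kernelME// -ge0_integralZl_EFin//.
  - by move=> y _; rewrite lee_fin mulr_ge0.
  - apply/measurable_EFinP; apply: measurable_funM => //; exact: measurable_kernel.
rewrite (fubini_tonelli F mF F0); apply: eq_integral => y _.
rewrite (mulrC (acc_mass y)) mulrA EFinM acc_massE -ge0_integralZl_EFin//.
- by apply: eq_integral => x _; rewrite /F/= -EFinM mulrA rev; congr EFin; ring.
- by move=> x _; rewrite lee_fin.
- by apply/measurable_EFinP; exact: measurable_kernel.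
- by rewrite mulr_ge0.
Qed.

(** * Drift, minorization and contraction *)

Hypothesis mV : measurable_fun setT V.
Hypothesis V0 : forall x, 0 <= V x.
Hypothesis pV : (\int[mu]_x (p x * V x)%:E < +oo)%E.
Variables g K L eps : R.
Hypothesis g01 : 0 <= g < 1.
Hypothesis K0 : 0 <= K.
Hypothesis drift : forall x,
  (\int[mu]_y (a x y * V y)%:E + ((1 - acc_mass x) * V x)%:E <= (g * V x + K)%:E)%E.
Hypothesis mw : measurable_fun setT w.
Hypothesis w0 : forall x, 0 <= w x.
Hypothesis w1 : (\int[mu]_x (w x)%:E = 1)%E.
Hypothesis eps01 : 0 < eps <= 1.
Hypothesis KL : 2 * K < (1 - g) * L.
Hypothesis small : forall x y, V x <= L -> eps * w y <= a x y.

(** The drift inequality lives in the extended reals, so it is itself what makes the [V]-moment of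
    the kernel finite. *)
Lemma integrable_kernelV x : mu.-integrable setT (EFin \o (fun y => a x y * V y)).
Proof.
apply: ge0_integrable.
- by apply: measurable_funM => //; exact: measurable_kernel.
- by move=> y; rewrite mulr_ge0.
- have /andP[A0 A1] := acc_mass01 x.
  rewrite (@le_lt_trans _ _ (g * V x + K)%:E)%E ?ltry// (le_trans _ (drift x))//.
  by rewrite leeDl// lee_fin mulr_ge0// subr_ge0.
Qed.

Lemma mh_op_drift x : mh_op V x <= g * V x + K.
Proof.
rewrite -lee_fin (le_trans _ (drift x))// /mh_op EFinD leeD2r// fineK//.
exact: (integrable_fin_num _ (integrable_kernelV x)).
Qed.

Lemma integrable_minorant : mu.-integrable setT (EFin \o w).
Proof. by apply: ge0_integrable; rewrite // w1 ltry. Qed.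

(** Write [a x] as [e w] plus a nonnegative remainder. The part [e w] contributes a number
    independent of [x], which cancels between two starting points; the weighted bound on [f - c] is
    integrated against the remainder and the atom, of total mass [1 - e]. With [e = 0] only the
    drift is used. *)
Lemma mh_op_osc (f : T -> R) (k b c e : R) x :
  measurable_fun setT f -> (forall y, `|f y| <= 1) ->
  0 <= k -> 0 <= b -> 0 <= e ->
  (forall y, `|f y - c| <= k * (1 + b * V y)) ->
  (forall y, e * w y <= a x y) ->
  `|mh_op f x - c - e * (\int[mu]_y (w y * f y) - c)| <=
    k * (1 - e + b * mh_op V x).
Proof.
move=> mf f1 k0 b0 e0 fc ea.
have ia := integrable_kernel x; have iaV := integrable_kernelV x.
have iw := integrable_minorant.
have iaf := integrable_kernelM x mf f1.
have iwf : mu.-integrable setT (EFin \o (fun y => w y * f y)).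
  apply: (bounded_integrable _ _ iw); first exact: measurable_funM.
  by move=> y; rewrite normrM ger0_norm// ler_piMr.
have wI : \int[mu]_y w y = 1 by rewrite /Rintegral w1.
pose h1 y := a x y * f y - c * a x y; pose h2 y := e * (w y * f y) - (e * c) * w y.
have ih1 : mu.-integrable setT (EFin \o h1).
  by apply: integrable_subr => //; exact: integrable_scale.
have ih2 : mu.-integrable setT (EFin \o h2).
  by apply: integrable_subr => //; exact: integrable_scale.
have hE : \int[mu]_y (h1 y - h2 y) = \int[mu]_y (a x y * f y) - c * acc_mass x
    - (e * \int[mu]_y (w y * f y) - e * c).
  rewrite RintegralB// /h1 /h2 !RintegralB//; try exact: integrable_scale.
  by rewrite !RintegralZl// wI mulr1.
have hb : `|\int[mu]_y (h1 y - h2 y)| <=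
    k * acc_mass x + k * b * \int[mu]_y (a x y * V y) - k * e.
  apply: (le_trans (le_normr_Rintegral _ _)) => //; first exact: integrable_subr.
  pose u y := k * a x y + k * b * (a x y * V y) - k * e * w y.
  have iu0 : mu.-integrable setT
      (EFin \o (fun y => k * a x y + k * b * (a x y * V y))).
    by apply: integrable_addr => //; exact: integrable_scale.
  apply: (@le_trans _ _ (\int[mu]_y u y)).
    apply: le_Rintegral => //.
    - by apply: integrable_norm; exact: integrable_subr.
    - by apply: integrable_subr => //; exact: integrable_scale.
    move=> y _; rewrite (_ : h1 y - h2 y = (a x y - e * w y) * (f y - c)); last first.
      by rewrite /h1 /h2; ring.
    rewrite normrM ger0_norm ?subr_ge0//.
    apply: (le_trans (ler_wpM2l _ (fc y))); first by rewrite subr_ge0.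
    (* Dropping this nonnegative term keeps the bound free of the integral of [w * V]. *)
    rewrite /u; have : 0 <= k * b * (e * w y * V y) by rewrite !mulr_ge0.
    lra.
  rewrite /u RintegralB//; last exact: integrable_scale.
  rewrite RintegralD//; try exact: integrable_scale.
  by rewrite !RintegralZl// wI mulr1.
have /andP[A0 A1] := acc_mass01 x.
rewrite (_ : mh_op f x - c - _ =
  \int[mu]_y (h1 y - h2 y) + (1 - acc_mass x) * (f x - c)); last first.
  by rewrite hE /mh_op; ring.
apply: (le_trans (ler_normD _ _)).
rewrite normrM (ger0_norm (_ : 0 <= 1 - acc_mass x)) ?subr_ge0//.
have : (1 - acc_mass x) * `|f x - c| <= (1 - acc_mass x) * (k * (1 + b * V x)).
  by rewrite ler_wpM2l// subr_ge0.
rewrite /mh_op; nra.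
Qed.

(** The intervals of centre [f x] and radius [k (1 + b V x)] meet pairwise, hence have a common
    point (Helly on the line): the supremum of their left ends. *)
Lemma osc_center (f : T -> R) (k b : R) :
  (forall x y, `|f x - f y| <= k * (2 + b * (V x + V y))) ->
  exists c, forall x, `|f x - c| <= k * (1 + b * V x).
Proof.
move=> fo.
pose S := range (fun x => f x - k * (1 + b * V x)).
have Sub y : ubound S (f y + k * (1 + b * V y)).
  move=> _ [x _ <-]; have := fo x y; rewrite ler_norml => /andP[_]; lra.
have hS : has_sup S.
  by split; [exists (f point - k * (1 + b * V point)), point|
             exists (f point + k * (1 + b * V point))].
exists (sup S) => x; rewrite ler_norml; apply/andP; split.
- have : sup S <= f x + k * (1 + b * V x) by apply: ge_sup => //; case: hS.
  lra.
- have : f x - k * (1 + b * V x) <= sup S by apply: ub_le_sup; [case: hS|exists x].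
  lra.
Qed.

(* Hairer--Mattingly: the oscillation seminorm weighted by [2 + b (V x + V y)]
   is contracted; far out by the drift, inside [V <= L] by the common part [eps w]. *)
Lemma mh_op_contract (b r : R) : 0 < b -> 0 <= r ->
  (forall S, L <= S -> 2 + 2 * b * K + b * g * S <= r * (2 + b * S)) ->
  (forall S, 0 <= S -> 2 - 2 * eps + 2 * b * K + b * g * S <= r * (2 + b * S)) ->
  forall (f : T -> R) k, measurable_fun setT f -> (forall y, `|f y| <= 1) ->
  0 <= k -> (forall x y, `|f x - f y| <= k * (2 + b * (V x + V y))) ->
  forall x y, `|mh_op f x - mh_op f y| <= k * r * (2 + b * (V x + V y)).
Proof.
move=> b0 r0 rl rs f k mf f1 k0 fo x y.
have [c fc] := osc_center fo.
have Vxy0 : 0 <= V x + V y by rewrite addr_ge0.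
have [Lxy|xyL] := leP L (V x + V y).
- have e0w z z' : 0 * w z' <= a z z' by rewrite mul0r.
  have hx := mh_op_osc mf f1 k0 (ltW b0) (lexx 0) fc (e0w x).
  have hy := mh_op_osc mf f1 k0 (ltW b0) (lexx 0) fc (e0w y).
  have dx := mh_op_drift x; have dy := mh_op_drift y.
  have := rl _ Lxy => /(ler_wpM2l k0).
  have kb0 : 0 <= k * b by rewrite mulr_ge0// ltW.
  move: dx dy => /(ler_wpM2l kb0) dx /(ler_wpM2l kb0) dy.
  move: hx hy; rewrite !mul0r !subr0 !ler_norml => /andP[? ?] /andP[? ?] ?.
  by apply/andP; split; lra.
- have /andP[e0 e1] := eps01.
  have xL : V x <= L by have := V0 y; lra.
  have yL : V y <= L by have := V0 x; lra.
  have hx := mh_op_osc mf f1 k0 (ltW b0) (ltW e0) fc (fun z => small z xL).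
  have hy := mh_op_osc mf f1 k0 (ltW b0) (ltW e0) fc (fun z => small z yL).
  have dx := mh_op_drift x; have dy := mh_op_drift y.
  have := rs _ Vxy0 => /(ler_wpM2l k0).
  have kb0 : 0 <= k * b by rewrite mulr_ge0// ltW.
  move: dx dy => /(ler_wpM2l kb0) dx /(ler_wpM2l kb0) dy.
  move: hx hy; rewrite !ler_norml => /andP[? ?] /andP[? ?] ?.
  by apply/andP; split; lra.
Qed.

Theorem harris : exists (r : R) (M : T -> R), 0 <= r < 1 /\
  forall x n (f : T -> R), measurable_fun setT f -> (forall y, 0 <= f y <= 1) ->
    `|iter n mh_op f x - \int[mu]_y (p y * f y)| <= M x * r ^+ n.
Proof.
have [b [r [b0 /andP[r0 r1] rl rs]]] := contraction_rate g01 K0 KL eps01.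
have ip := integrable_density.
have ipV : mu.-integrable setT (EFin \o (fun y => p y * V y)).
  by apply: ge0_integrable => //; [exact: measurable_funM|move=> y; exact: mulr_ge0].
have pI : \int[mu]_y p y = 1 by rewrite /Rintegral p1.
(* The average under [p] in [y] of the weight [2 + b (V x + V y)]. *)
exists r, (fun x => 2 + b * V x + b * \int[mu]_y (p y * V y)).
rewrite r0 r1; split=> // x n f mf f01.
have nb (h : T -> R) : (forall y, 0 <= h y <= 1) -> forall y, `|h y| <= 1.
  by move=> h01 y; case/andP: (h01 y) => ? ?; rewrite ger0_norm.
have contr m : forall x y, `|iter m mh_op f x - iter m mh_op f y| <=
    r ^+ m * (2 + b * (V x + V y)).
  elim: m => [|m IH] u v /=.
    rewrite expr0 mul1r; have /andP[? ?] := f01 u; have /andP[? ?] := f01 v.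
    have : 0 <= b * (V u + V v) by apply: mulr_ge0; [exact: ltW|exact: addr_ge0].
    by move=> ?; rewrite ler_norml; apply/andP; split; lra.
  rewrite exprSr; have [mi i01] := iter_mh_op m mf f01.
  by apply: (mh_op_contract b0 r0 rl rs) => //; [exact: nb|exact: exprn_ge0].
have [mi i01] := iter_mh_op n mf f01.
(* By invariance the error becomes the [p]-average over [y] of [F x - F y], to which the contracted
   oscillation applies. *)
have -> : \int[mu]_y (p y * f y) = \int[mu]_y (p y * iter n mh_op f y).
  elim: {mi i01} n => // m IH; have [mi i01] := iter_mh_op m mf f01.
  by rewrite /= mh_op_invariant.
set F := iter n mh_op f in mi i01 contr *.
have ipF : mu.-integrable setT (EFin \o (fun y => p y * F y)).
  by apply: integrable_densityM => //; exact: nb.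
have -> : F x - \int[mu]_y (p y * F y) = \int[mu]_y (F x * p y - p y * F y).
  by rewrite RintegralB//; [rewrite RintegralZl// pI mulr1|exact: integrable_scale].
apply: (le_trans (le_normr_Rintegral _ _)) => //.
  by apply: integrable_subr => //; exact: integrable_scale.
pose B := r ^+ n * (2 + b * V x).
apply: (@le_trans _ _ (\int[mu]_y (B * p y + r ^+ n * b * (p y * V y)))).
  apply: le_Rintegral => //.
  - by apply: integrable_norm; apply: integrable_subr => //; exact: integrable_scale.
  - by apply: integrable_addr => //; exact: integrable_scale.
  move=> y _; rewrite (mulrC (p y)) -mulrBl normrM (ger0_norm (p0 y)).
  apply: (le_trans (ler_wpM2r (p0 y) (contr n x y))).
  by rewrite /B; lra.
rewrite RintegralD//; [|exact: integrable_scale..].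
by rewrite !RintegralZl// pI /B; lra.
Qed.

End Harris.

(** * Proximal map and Moreau envelope *)

(** Locked so that rewriting and arithmetic treat inner products as atoms. *)
HB.lock Definition dotv (R : realType) d (u v : 'rV[R]_d) : R :=
  \sum_(i < d) u ord0 i * v ord0 i.

Section Euclid.
Variables (R : realType) (d : nat).
Implicit Types u v w x : 'rV[R]_d.

Lemma enorm_sqr v : enorm v ^+ 2 = dotv v v.
Proof.
by rewrite /enorm dotv.unlock sqr_sqrtr ?sumr_ge0// => i _; exact: sqr_ge0.
Qed.

Lemma enorm_ge0 v : 0 <= enorm v. Proof. exact: sqrtr_ge0. Qed.

Lemma dotv_ge0 v : 0 <= dotv v v.
Proof. by rewrite dotv.unlock sumr_ge0// => i _; exact: sqr_ge0. Qed.

Lemma dotvC u v : dotv u v = dotv v u.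
Proof. by rewrite dotv.unlock; apply: eq_bigr => i _; rewrite mulrC. Qed.

Lemma dotvDl u v w : dotv (u + v) w = dotv u w + dotv v w.
Proof.
by rewrite dotv.unlock -big_split; apply: eq_bigr => i _; rewrite mxE mulrDl.
Qed.

Lemma dotvZl t u w : dotv (t *: u) w = t * dotv u w.
Proof.
by rewrite dotv.unlock mulr_sumr; apply: eq_bigr => i _; rewrite mxE mulrA.
Qed.

Lemma dotvNl u w : dotv (- u) w = - dotv u w.
Proof. by rewrite -scaleN1r dotvZl mulN1r. Qed.

Lemma dotvDr u v w : dotv w (u + v) = dotv w u + dotv w v.
Proof. by rewrite dotvC dotvDl !(dotvC w). Qed.

Lemma dotvZr t u w : dotv w (t *: u) = t * dotv w u.
Proof. by rewrite dotvC dotvZl !(dotvC w). Qed.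

Lemma dotvNr u w : dotv w (- u) = - dotv w u.
Proof. by rewrite dotvC dotvNl !(dotvC w). Qed.

Definition dotvE := (dotvDl, dotvDr, dotvZl, dotvZr, dotvNl, dotvNr).

Lemma dotv_sqrD u v : dotv (u + v) (u + v) = dotv u u + 2 * dotv u v + dotv v v.
Proof. by rewrite !dotvE (dotvC v u); ring. Qed.

Lemma dotv_delta u i : dotv u (delta_mx ord0 i) = u ord0 i.
Proof.
rewrite dotv.unlock (bigD1 i)//= mxE !eqxx mulr1 big1 ?addr0// => j ji.
by rewrite mxE (negPf ji) mulr0.
Qed.

Lemma dotv_amgm u v s : 0 < s -> 2 * dotv u v <= s * dotv u u + s^-1 * dotv v v.
Proof.
move=> s0; rewrite -subr_ge0.
rewrite (_ : _ - _ = s^-1 * dotv (s *: u - v) (s *: u - v)).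
  by rewrite mulr_ge0 ?dotv_ge0// invr_ge0 ltW.
by rewrite !dotvE (dotvC v u); field; rewrite gt_eqF.
Qed.

Lemma coord_le_norm u i : `|u ord0 i| <= `|u|.
Proof.
rewrite [leRHS]/Num.Def.normr/= mx_normrE.
exact: (@le_bigmax _ R _ 0 (fun ij => `|u ij.1 ij.2|) (ord0, i)).
Qed.

Lemma norm_row_le u M : 0 <= M -> (forall i, `|u ord0 i| <= M) -> `|u| <= M.
Proof.
move=> M0 uM; rewrite [leLHS]/Num.Def.normr/= mx_normrE.
by apply: bigmax_le => // -[i j] _; rewrite /= ord1.
Qed.

Lemma dotv_norm u v : `|dotv u v| <= d%:R * `|u| * `|v|.
Proof.
rewrite dotv.unlock; apply: (le_trans (ler_norm_sum _ _ _)).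
apply: (@le_trans _ _ (\sum_(i < d) `|u| * `|v|)).
  by apply: ler_sum => i _; rewrite normrM ler_pM// coord_le_norm.
by rewrite sumr_const card_ord -mulrA mulr_natl.
Qed.

Lemma coord_sqr_le u i : u ord0 i ^+ 2 <= dotv u u.
Proof.
rewrite dotv.unlock (bigD1 i)//= -expr2 lerDl sumr_ge0// => j _; exact: sqr_ge0.
Qed.

(** Passes from increment estimates to the topology, whose norm is the sup norm. The radius is at
    most 1, so the quadratic term is bounded by a linear one. *)
Lemma continuous_quad_bound (f : 'rV[R]_d -> R) (x : 'rV[R]_d) A B : 0 <= A -> 0 <= B ->
  (forall u, `|f (x + u) - f x| <= A * `|u| + B * `|u| ^+ 2) ->
  {for x, continuous f}.
Proof.
move=> A0 B0 fb; apply: (iffRL (@cvgrPdist_lt _ _ _ (nbhs x) (nbhs_filter x) f (f x))) => e e0.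
pose r := Num.min 1 (e / (A + B + 1)).
have AB : 0 < A + B + 1 by lra.
have r0 : 0 < r by rewrite lt_min ltr01 divr_gt0.
apply/nbhs_ballP; exists r => //= y; rewrite mx_norm_ball /ball_/= distrC => yr.
have := fb (y - x); rewrite (addrC x) subrK => fy.
rewrite distrC; apply: (le_lt_trans fy).
move: yr; rewrite lt_min => /andP[y1 ye].
have : `|y - x| * (A + B + 1) < e by rewrite -ltr_pdivlMr.
have := normr_ge0 (y - x); move: y1; move: `|y - x| => t t1 t0 te.
have : B * (t * t) <= B * (t * 1) by rewrite ler_wpM2l// ler_wpM2l// ltW.
by rewrite expr2; lra.
Qed.

End Euclid.

Section Prox.
Variables (R : realType) (d : nat) (psi : 'rV[R]_d -> \bar R) (lam m : R).
Hypothesis psip : proper_fun psi.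
Hypothesis psil : lsc psi.
Hypothesis psic : convex_fun psi.
Hypothesis psim : forall x, (m%:E <= psi x)%E.
Hypothesis lam0 : 0 < lam.

Implicit Types x y u p : 'rV[R]_d.

Let obj x y := (psi y + (dotv (y - x) (y - x) / (2 * lam))%:E)%E.

Lemma moreauE x : moreau psi lam x = ereal_inf (range (obj x)).
Proof.
by rewrite /moreau; congr (ereal_inf (_ @` _)); apply/funext => y;
  rewrite enorm_sqr.
Qed.

Lemma moreau_le x y : (moreau psi lam x <= obj x y)%E.
Proof. by rewrite moreauE; apply: ereal_inf_lbound; exists y. Qed.

Lemma obj_ge x y : ((m + dotv (y - x) (y - x) / (2 * lam))%:E <= obj x y)%E.
Proof. by rewrite EFinD /obj leeD2r. Qed.

Lemma moreau_fin x : moreau psi lam x = (moreauR psi lam x)%:E.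
Proof.
rewrite /moreauR fineK// fin_numE; apply/andP; split.
- rewrite gt_eqF// (@lt_le_trans _ _ m%:E) ?ltNyr//.
  rewrite moreauE; apply: le_ereal_inf_tmp => _ [y _ <-].
  rewrite (le_trans _ (obj_ge x y))// lee_fin lerDl divr_ge0 ?dotv_ge0//.
  by rewrite mulr_ge0 ?ltW.
- have [[y yoo] psiNy] := psip.
  rewrite lt_eqF// (le_lt_trans (moreau_le x y))//.
  by rewrite /obj lte_add_pinfty// ltry.
Qed.

Lemma obj_lsc x : lsc (obj x).
Proof.
move=> p a.
rewrite /obj => ap.
(* A level [c] below [psi p] that still leaves slack above [a] once the quadratic term is added; the
   slack absorbs the variation of that term. Where [psi p] is infinite, [c] is chosen freely. *)
have [[c ac cp] _] : (exists2 c : R, a < c + dotv (p - x) (p - x) / (2 * lam) &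
    (c%:E < psi p)%E) /\ True.
  split=> //; case: (psi p) (psim p) ap => [b| |//] _.
    rewrite -EFinD lte_fin => ab.
    exists (b - (b + dotv (p - x) (p - x) / (2 * lam) - a) / 2); last first.
      by rewrite lte_fin; lra.
    lra.
  move=> _; exists (a + 1 - dotv (p - x) (p - x) / (2 * lam)); last by rewrite ltry.
  lra.
have qc : {for p, continuous (fun y : 'rV[R]_d => dotv (y - x) (y - x) / (2 * lam))}.
  pose A := 2 * (d%:R * `|p - x|) / (2 * lam); pose B := d%:R / (2 * lam).
  have l0 : 0 < (2 * lam)^-1 by rewrite invr_gt0 mulr_gt0.
  apply: (@continuous_quad_bound _ _ _ _ A B).
  - by rewrite /A !mulr_ge0// ltW.
  - by rewrite /B mulr_ge0// ltW.
  move=> u; rewrite (addrAC p) -mulrBl normrM (gtr0_norm l0) /A /B.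
  rewrite mulrAC (mulrAC d%:R) -mulrDl ler_pM2r//.
  rewrite !dotvE (dotvC u).
  have h1 := dotv_norm (p - x) u; have h2 := dotv_norm u u.
  move: h1; rewrite !dotvE => h1.
  rewrite (_ : _ - _ = 2 * (dotv p u - dotv x u) + dotv u u); last by rewrite (dotvC u); ring.
  apply: (le_trans (ler_normD _ _)); rewrite normrM ger0_norm//.
  rewrite expr2; lra.
have e0 : 0 < c + dotv (p - x) (p - x) / (2 * lam) - a by lra.
near=> y.
have hq : `|dotv (p - x) (p - x) / (2 * lam) - dotv (y - x) (y - x) / (2 * lam)| <
   c + dotv (p - x) (p - x) / (2 * lam) - a.
  by near: y; move/cvgrPdist_lt : qc => /(_ _ e0).
have hp : (c%:E < psi y)%E by near: y; exact: psil.
apply: (@lt_trans _ _ (c%:E + (dotv (y - x) (y - x) / (2 * lam))%:E)%E).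
  rewrite -EFinD lte_fin; move: hq; rewrite ltr_norml => /andP[_]; lra.
by rewrite lteD2rE.
Unshelve. all: by end_near. Qed.

(** Direct method: the lower bound on [psi] keeps a minimising sequence bounded, compactness gives a
    cluster point, and lower semicontinuity makes it a minimiser. *)
Lemma argmin_exists x : exists y, obj x y = moreau psi lam x.
Proof.
pose e := moreauR psi lam x.
have ey n : exists y, (obj x y < (e + n.+1%:R^-1)%:E)%E.
  have : (moreau psi lam x < (e + n.+1%:R^-1)%:E)%E.
    by rewrite moreau_fin lte_fin ltrDl invr_gt0.
  by rewrite moreauE => /ereal_inf_lt[_ [y _ <-] ?]; exists y.
have [u uP] := choice ey.
(* [C] bounds the squared distance from [u n] to [x]; the radius [1 + |C|] then bounds the distance
   without a square root. *)
pose C := 2 * lam * (e + 1 - m).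
pose S := [set y : 'rV[R]_d | `|y| <= `|x| + (1 + `|C|)].
have cS : compact S.
  apply: bounded_closed_compact.
    exists (`|x| + (1 + `|C|)); split; first exact: num_real.
    by move=> M xM y /= yS; rewrite (le_trans yS)// ltW.
  apply: (@closed_comp _ _ (fun y : 'rV[R]_d => `|y|) [set t | t <= _]).
    by move=> y _; exact: norm_continuous.
  exact: closed_le.
have uS n : S (u n).
  rewrite /S/= -[u n](subrK x) addrC (le_trans (ler_normD _ _))//.
  rewrite lerD2l; apply: norm_row_le => [|i]; first by rewrite addr_ge0.
  have := le_lt_trans (obj_ge x (u n)) (uP n); rewrite lte_fin => h.
  have n1 : n.+1%:R^-1 <= 1 :> R by rewrite invf_le1// ler1n.
  have : dotv (u n - x) (u n - x) / (2 * lam) <= e + 1 - m.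
    by move: n.+1%:R^-1 h n1 => z h n1; lra.
  rewrite ler_pdivrMr ?mulr_gt0// mulrC -/C => hC.
  have := le_trans (coord_sqr_le (u n - x) i) hC.
  move/(fun h => le_trans h (ler_norm C)); rewrite -real_normK ?num_real//.
  have := normr_ge0 ((u n - x) ord0 i); have := normr_ge0 C.
  nra.
have [|p [_ clp]] := cS (u @ \oo) _.
  by exists 0%N => // n _; exact: uS.
exists p; apply/eqP; rewrite eq_le moreau_le andbT moreau_fin leNgt.
apply/negP => ep.
have [a ea ap] : exists2 a : R, e < a & (a%:E < obj x p)%E.
  case: (obj x p) ep => [b| |//].
    by rewrite lte_fin -/e => eb; exists ((e + b) / 2); rewrite ?lte_fin; lra.
  by move=> _; exists (e + 1); rewrite ?ltry//; lra.
pose k := Num.truncn (a - e)^-1.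
have [|q [[n /= kn qE] aq]] := clp [set u n | n in [set n | (k <= n)%N]]
    [set y | (a%:E < obj x y)%E] _ (obj_lsc ap).
  by exists k => // n /= kn; exists n.
move: aq; rewrite /= -qE => aq.
have := lt_trans aq (uP n); rewrite lte_fin.
have : n.+1%:R^-1 < a - e.
  rewrite invf_plt ?posrE ?subr_gt0// (lt_le_trans (truncnS_gt _))//.
  by rewrite ler_nat ltnS.
by move: n.+1%:R^-1 => z; lra.
Qed.

Local Notation prx := (prox psi lam).
Local Notation env := (moreauR psi lam).

Lemma obj_prox x : obj x (prx x) = (env x)%:E.
Proof.
have [y yE] := argmin_exists x.
rewrite -moreau_fin /prox.
have := @xgetPex _ 0 [set y | (psi y + ((enorm (y - x)) ^+ 2 / (2 * lam))%R%:E)%E =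
  moreau psi lam x].
by rewrite /= enorm_sqr; apply; exists y; rewrite /= enorm_sqr.
Qed.

Lemma psi_prox_fin x : psi (prx x) = (fine (psi (prx x)))%:E.
Proof.
have := obj_prox x; rewrite /obj; have [_ /(_ (prx x))] := psip.
by case: (psi _) => //.
Qed.

Lemma envE x : env x =
  fine (psi (prx x)) + dotv (prx x - x) (prx x - x) / (2 * lam).
Proof.
by have := obj_prox x; rewrite /obj psi_prox_fin -EFinD => -[].
Qed.

Lemma env_le x y b : psi y = b%:E -> env x <= b + dotv (y - x) (y - x) / (2 * lam).
Proof. by move=> yb; have := moreau_le x y; rewrite moreau_fin /obj yb -EFinD lee_fin. Qed.

Lemma env_ge x : m + dotv (prx x - x) (prx x - x) / (2 * lam) <= env x.
Proof. by rewrite -lee_fin -obj_prox; exact: obj_ge. Qed.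

(** First-order optimality: [(x - p) / lam] is a subgradient of [psi] at [p = prox x]. If the
    inequality failed by [D], moving from [p] towards [y] by a fraction [t] would gain [t D] by
    convexity and lose only a term in [t^2]. *)
Lemma prox_subgradient x y b : psi y = b%:E ->
  fine (psi (prx x)) + dotv (x - prx x) (y - prx x) / lam <= b.
Proof.
move=> yb; set p := prx x; set a := fine _.
have pa : psi p = a%:E by exact: psi_prox_fin.
rewrite leNgt; apply/negP => hb.
pose D := a + dotv (x - p) (y - p) / lam - b.
have D0 : 0 < D by rewrite /D; lra.
pose q := dotv (y - p) (y - p).
have q0 : 0 <= q by exact: dotv_ge0.
(* Small enough that [t q <= lam D], whereas minimality forces [2 lam D <= t q]; the [+ 1] covers
   [q = 0]. *)
pose t := Num.min 1 (lam * D / (q + 1)).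
have q1 : 0 < q + 1 by lra.
have t0 : 0 < t by rewrite lt_min ltr01 divr_gt0// mulr_gt0.
have t1 : t <= 1 by rewrite ge_min lexx.
have tq : t * (q + 1) <= lam * D by rewrite -ler_pdivlMr// ge_min lexx orbT.
have tI : 0 <= t <= 1 by rewrite (ltW t0).
have := le_trans (moreau_le x (t *: y + (1 - t) *: p))
  (leeD2r _ (psic y p tI)).
rewrite moreau_fin pa yb -!EFinM -!EFinD lee_fin envE -/p -/a.
rewrite (_ : t *: y + (1 - t) *: p - x = (p - x) + t *: (y - p)); last first.
  by apply/rowP => i; rewrite !mxE; ring.
rewrite -(ler_pM2r (_ : 0 < 2 * lam)); last by rewrite mulr_gt0.
rewrite !mulrDl !divfK ?gt_eqF ?mulr_gt0//.
rewrite [dotv (p - x + _) _]dotvDl [dotv (p - x) (p - x + _)]dotvDr.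
rewrite [dotv (t *: _) _]dotvDr !dotvZl !dotvZr -/q (dotvC (y - p)).
have -> : dotv (p - x) (y - p) = - dotv (x - p) (y - p) by rewrite -opprB dotvNl.
have lD : lam * D = lam * a + dotv (x - p) (y - p) - lam * b.
  by rewrite /D; field; rewrite gt_eqF.
have lD0 : 0 < lam * D by rewrite mulr_gt0.
rewrite lD in tq lD0; move: tq lD0.
set z := dotv (x - p) (y - p) => tq lD0 h.
have : t * (2 * (lam * a + z - lam * b)) <= t * (t * q) by lra.
rewrite ler_pM2l//.
- by rewrite leNgt => /negP; apply; lra.
- by rewrite !mul1r addr_gt0.
- by rewrite !mul1r addr_gt0.
Qed.

(** Adding the subgradient inequalities at the two points gives firm nonexpansiveness,
    [|p - q|^2 <= (x - y).(p - q)]; Young's inequality finishes. *)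
Lemma prox_nonexp x y :
  dotv (prx x - prx y) (prx x - prx y) <= dotv (x - y) (x - y).
Proof.
have h1 := prox_subgradient x (psi_prox_fin y).
have h2 := prox_subgradient y (psi_prox_fin x).
set p := prx x in h1 h2 *; set q := prx y in h1 h2 *.
move: (fine _) (fine _) h1 h2 => a b; clearbody p q => h1 h2.
have h : dotv (x - p) (q - p) + dotv (y - q) (p - q) <= 0.
  rewrite -(ler_pM2r (_ : 0 < lam^-1)) ?invr_gt0// mul0r mulrDl; lra.
have e : dotv (x - p) (q - p) + dotv (y - q) (p - q) =
    dotv (p - q) (p - q) - dotv (x - y) (p - q).
  by rewrite -(opprB p q) !dotvE (dotvC q p); ring.
have := dotv_amgm (x - y) (p - q) ltr01; rewrite invr1 !mul1r; lra.
Qed.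

(** The upper bound tests the infimum at [x + u] with [prox x]; the lower bound tests the one at [x]
    with [prox (x + u)], and nonexpansiveness controls the cross term [(q - p).u]. *)
Lemma env_expand x u :
  `|env (x + u) - env x - dotv (x - prx x) u / lam| <= dotv u u / (2 * lam).
Proof.
have I0 : 0 < (2 * lam)^-1 by rewrite invr_gt0 mulr_gt0.
have lamI : lam^-1 = 2 * (2 * lam)^-1 by field; rewrite gt_eqF.
have h1 := env_le (x + u) (psi_prox_fin x).
have h2 := env_le x (psi_prox_fin (x + u)).
have ne := prox_nonexp (x + u) x; rewrite (addrC x) addrK (addrC u) in ne.
have e1 := envE x; have e2 := envE (x + u).
set p := prx x in ne h1 h2 e1 e2 *; set q := prx (x + u) in ne h1 h2 e1 e2 *.
move: (env x) (env (x + u)) (fine _) (fine _) h1 h2 e1 e2 => F F' a b h1 h2 e1 e2.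
clearbody p q.
have am := dotv_amgm (q - p) u ltr01; rewrite invr1 !mul1r in am.
have E1 : dotv (p - (x + u)) (p - (x + u)) =
    dotv (p - x) (p - x) + 2 * dotv (x - p) u + dotv u u.
  by rewrite opprD addrA [LHS]dotv_sqrD !dotvNr !dotvNl -(opprB x p) !dotvNl; ring.
have E2 : dotv (q - x) (q - x) = dotv (q - (x + u)) (q - (x + u)) +
    2 * dotv (q - p) u - 2 * dotv (x - p) u - dotv u u.
  rewrite (_ : q - x = q - (x + u) + u); last by rewrite opprD addrA subrK.
  by rewrite [LHS]dotv_sqrD !(dotvDl, dotvNl); ring.
have hI : 2 * dotv (q - p) u * (2 * lam)^-1 <= 2 * dotv u u * (2 * lam)^-1.
  by rewrite ler_pM2r//; lra.
rewrite E1 in h1; rewrite E2 in h2.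
rewrite lamI ler_norml; apply/andP; split; lra.
Qed.

Lemma env_derive x u : 'D_u env x = dotv (x - prx x) u / lam.
Proof.
rewrite /derive; apply: cvg_lim => //.
have I0 : 0 < (2 * lam)^-1 by rewrite invr_gt0 mulr_gt0.
apply/cvgrPdist_le => e e0.
pose C := dotv u u / (2 * lam).
have C0 : 0 <= C by rewrite mulr_ge0 ?dotv_ge0// ltW.
have C1 : 0 < C + 1 by lra.
near=> h.
have h0 : h != 0 by near: h; exact: nbhs_dnbhs_neq.
have hC : `|h| < e / (C + 1) by near: h; apply: dnbhs0_lt; rewrite divr_gt0.
have eh := env_expand x (h *: u).
rewrite dotvZl !dotvZr [x + _]addrC in eh.
rewrite distrC /= -[X in X - _]/(h^-1 * (env (h *: u + x) - env x)).
move: eh; set D := dotv (x - prx x) u; set F := env x; set F' := env _.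
clearbody D F F' => eh.
rewrite (_ : _ - _ = h^-1 * (F' - F - h * D / lam)); last first.
  by field; rewrite h0 gt_eqF.
rewrite normrM normfV ler_pdivrMl ?normr_gt0// (le_trans eh)//.
rewrite mulrA -expr2 -mulrA -/C -real_normK ?num_real// expr2 -mulrA.
rewrite ler_wpM2l// (@le_trans _ _ (`|h| * (C + 1)))//.
  by rewrite ler_wpM2l// lerDl.
by rewrite -ler_pdivlMr// ltW.
Unshelve. all: by end_near. Qed.

Lemma env_grad x : grad env x = lam^-1 *: (x - prx x).
Proof.
by apply/rowP => i; rewrite mxE env_derive dotv_delta !mxE mulrC.
Qed.

Lemma env_continuous : continuous env.
Proof.
move=> x; have I0 : 0 <= (2 * lam)^-1 by rewrite invr_ge0 mulr_ge0 ?ltW.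
have J0 : 0 <= lam^-1 by rewrite invr_ge0 ltW.
apply: (@continuous_quad_bound _ _ _ _ (d%:R * `|x - prx x| / lam)
  (d%:R / (2 * lam))).
- by rewrite !mulr_ge0.
- by rewrite !mulr_ge0.
move=> u; have h := env_expand x u.
rewrite -[_ - _](subrK (dotv (x - prx x) u / lam)).
rewrite (le_trans (ler_normD _ _))// addrC lerD//.
  rewrite normrM (ger0_norm J0) [leRHS]mulrAC ler_wpM2r//.
  exact: dotv_norm.
rewrite (le_trans h)// [leRHS]mulrAC ler_wpM2r// expr2 mulrA.
by rewrite (le_trans _ (dotv_norm _ _))// ler_norm.
Qed.

Lemma prox_coord_continuous i : continuous (fun x => prx x ord0 i).
Proof.
move=> x; apply: (@continuous_quad_bound _ _ _ _ d%:R 0) => //.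
move=> u; rewrite mul0r addr0.
have := prox_nonexp (x + u) x; rewrite (addrC x) addrK => h.
have := le_trans (coord_sqr_le _ i) h; rewrite !mxE => h1.
have h2 := le_trans (ler_norm _) (dotv_norm u u).
have := le_trans h1 h2.
rewrite -real_normK ?num_real// => h3.
rewrite -(@ler_pXn2r _ 2)// ?nnegrE ?mulr_ge0//.
rewrite (le_trans h3)// exprMn -mulrA -expr2 ler_wpM2r ?sqr_ge0//.
by rewrite -natrX ler_nat; case: (d) => // n; rewrite leq_pmulr.
Qed.

End Prox.

(** * Gaussian integrals *)

Section Gaussian.
Variable R : realType.

(** The constant [k] serves the induction: once the outer coordinate is fixed, its factor is
    absorbed into [k]. *)
Lemma intRd_prod n (I k : R) (g : 'I_n -> R -> R) : 0 <= k ->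
  (forall i, measurable_fun setT (g i : measurableTypeR R -> R)) ->
  (forall i t, 0 <= g i t) ->
  (forall i, (\int[@lebesgue_measure R]_t (g i t)%:E)%E = I%:E) ->
  intRd (fun v : 'rV[R]_n => (k * \prod_i g i (v ord0 i))%:E) = (k * I ^+ n)%:E.
Proof.
elim: n k g => [|n IH] k g k0 mg g0 gI /=; first by rewrite big_ord0 expr0.
have I0 : 0 <= I.
  by rewrite -lee_fin -(gI ord0); apply: integral_ge0 => t _; rewrite lee_fin.
have IHt t : intRd (fun v : 'rV[R]_n => (k * \prod_i g i (vcons t v ord0 i))%:E) =
    ((k * I ^+ n)%:E * (g ord0 t)%:E)%E.
  rewrite -EFinM mulrAC -(IH _ (fun i => g (lift ord0 i)))//; last exact: mulr_ge0.
  congr intRd; apply/funext => v; rewrite big_ord_recl vhead_vcons mulrA.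
  by congr (_ * _)%:E; apply: eq_bigr => i _; rewrite vcons_lift.
under eq_integral => t _ do rewrite IHt.
rewrite ge0_integralZl_EFin//=.
- by rewrite gI -EFinM exprSr mulrA.
- by move=> t _; rewrite lee_fin.
- exact/measurable_EFinP.
- by rewrite mulr_ge0// exprn_ge0.
Qed.

Lemma integral_gauss1 (s m : R) : 0 < s ->
  (\int[@lebesgue_measure R]_t (expR (- (s * (t - m) ^+ 2)))%:E)%E =
  (Num.sqrt (pi / s))%:E.
Proof.
(* The standard deviation for which the normal density has exponent [- s (t - m)^2]. *)
move=> s0; pose sg := Num.sqrt (2 * s)^-1.
have sg2 : sg ^+ 2 = (2 * s)^-1 by rewrite sqr_sqrtr// invr_ge0 mulr_ge0// ltW.
have sg0 : sg != 0 by rewrite gt_eqF// sqrtr_gt0 invr_gt0 mulr_gt0.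
have := integral_normal_pdf m sg.
have s0' : s != 0 by rewrite gt_eqF.
have peak : normal_peak sg = (Num.sqrt (pi / s))^-1.
  rewrite /normal_peak sg2; congr (Num.sqrt _)^-1.
  by rewrite -mulr_natr; field.
have S0 : 0 < Num.sqrt (pi / s) by rewrite sqrtr_gt0 divr_gt0// pi_gt0.
under eq_integral => t _.
  rewrite normal_pdfE//= peak /normal_fun sg2.
  rewrite (_ : - (t - m) ^+ 2 / _ = - (s * (t - m) ^+ 2)); last first.
    by rewrite -mulr_natr; field.
  rewrite EFinM.
over.
have mf : measurable_fun setT
    (fun t : measurableTypeR R => (expR (- (s * (t - m) ^+ 2)))%:E).
  apply/measurable_EFinP; apply: measurableT_comp => //.
  apply: measurable_funN; apply: measurable_funM => //.
  by apply: measurable_funX; exact: measurable_funB.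
rewrite ge0_integralZl_EFin//=.
move=> /(congr1 (fun z => (Num.sqrt (pi / s))%:E * z)%E).
by rewrite muleA -EFinM divff ?gt_eqF// mul1e mule1.
Qed.

Lemma intRd_gauss d (s : R) (c : 'rV[R]_d) : 0 < s ->
  intRd (fun y : 'rV[R]_d => (expR (- (s * dotv (y - c) (y - c))))%:E) =
  (Num.sqrt (pi / s) ^+ d)%:E.
Proof.
move=> s0.
rewrite -[RHS]/((_ ^+ d)%:E) -[in RHS](mul1r (_ ^+ d)).
rewrite -(@intRd_prod d _ _ (fun i t => expR (- (s * (t - c ord0 i) ^+ 2)))) //.
- congr intRd; apply/funext => y; rewrite mul1r -expR_sum; congr (expR _)%:E.
  rewrite sumrN -mulr_sumr; congr (- (_ * _)).
  by rewrite dotv.unlock; apply: eq_bigr => i _; rewrite !mxE expr2.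
- move=> i; apply: measurableT_comp => //.
  apply: measurable_funN; apply: measurable_funM => //.
  by apply: measurable_funX; exact: measurable_funB.
- by move=> i; exact: integral_gauss1.
Qed.

End Gaussian.

Section GaussianMoment.
Variables (R : realType) (d : nat).
Variable mu : {sigma_finite_measure set (rowB R d) -> \bar R}.
Hypothesis muE : forall f : rowB R d -> \bar R, measurable_fun setT f ->
  (forall x, 0 <= f x)%E -> intRd f = (\int[mu]_x f x)%E.

Lemma measurable_dotv dT (T : measurableType dT) (f g : T -> 'rV[R]_d) :
  (forall i, measurable_fun setT (fun x => f x ord0 i : R)) ->
  (forall i, measurable_fun setT (fun x => g x ord0 i : R)) ->
  measurable_fun setT (fun x => dotv (f x) (g x)).
Proof.
move=> mf mg; rewrite dotv.unlock.
by apply: measurable_sum => i; exact: measurable_funM.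
Qed.

Lemma measurable_dotvB (c : 'rV[R]_d) :
  measurable_fun setT (fun y : rowB R d => dotv (y - c) (y - c)).
Proof.
by apply: measurable_dotv => i; under eq_fun do rewrite !mxE;
  apply: measurable_funB => //; exact: coord_measurable.
Qed.

Lemma measurable_gauss (s : R) (c : 'rV[R]_d) :
  measurable_fun setT (fun y : rowB R d => expR (- (s * dotv (y - c) (y - c)))).
Proof.
apply: measurableT_comp => //; apply: measurable_funN.
by apply: measurable_funM => //; exact: measurable_dotvB.
Qed.

Lemma int_gauss (s : R) (c : 'rV[R]_d) : 0 < s ->
  (\int[mu]_y (expR (- (s * dotv (y - c) (y - c))))%:E)%E =
  (Num.sqrt (pi / s) ^+ d)%:E.
Proof.
move=> s0; rewrite -muE ?intRd_gauss//.
by apply/measurable_EFinP; exact: measurable_gauss.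
Qed.

(** Half of the exponent absorbs the factor [z], since [s z / 2 <= exp (s z / 2)]. *)
Lemma gauss_moment_le (s z : R) : 0 < s ->
  z * expR (- (s * z)) <= 2 / s * expR (- (s / 2 * z)).
Proof.
move=> s0.
have -> : - (s * z) = - (s / 2 * z) + - (s / 2 * z) by lra.
rewrite expRD mulrA ler_wpM2r ?expR_ge0// expRN.
rewrite ler_pdivrMr ?expR_gt0// mulrC -ler_pdivrMr ?divr_gt0// invf_div mulrC.
by rewrite (le_trans _ (expR_ge1Dx _))// mulrC lerDr.
Qed.

Lemma int_gauss_moment (s : R) (c : 'rV[R]_d) : 0 < s ->
  (\int[mu]_y (dotv (y - c) (y - c) * expR (- (s * dotv (y - c) (y - c))))%:E <=
  (2 / s * Num.sqrt (pi / (s / 2)) ^+ d)%:E)%E.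
Proof.
move=> s0; have s2 : 0 < s / 2 by rewrite divr_gt0.
rewrite EFinM -(int_gauss c s2) -ge0_integralZl_EFin//.
- apply: ge0_le_integral => //.
  + by move=> y _; rewrite lee_fin mulr_ge0 ?dotv_ge0 ?expR_ge0.
  + apply/measurable_EFinP; apply: measurable_funM; first exact: measurable_dotvB.
    exact: measurable_gauss.
  + apply/measurable_EFinP; apply: measurable_funM => //; exact: measurable_gauss.
  + by move=> y _; rewrite -EFinM lee_fin gauss_moment_le.
- by apply/measurable_EFinP; exact: measurable_gauss.
- by rewrite divr_ge0// ltW.
Qed.

End GaussianMoment.

(** * The MALA chain *)

Lemma limsup_norm_lt (R : realType) d (f : 'rV[R]_d -> R) (l k : R) :
  limsup_norm f = l%:E -> l < k ->
  exists r, forall x, r <= enorm x -> f x <= k.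
Proof.
move=> fl lk.
have : (limsup_norm f < k%:E)%E by rewrite fl lte_fin.
rewrite /limsup_norm => /ereal_inf_lt[_ [r _ <-] fk].
exists r => x rx; rewrite -lee_fin (le_trans _ (ltW fk))//.
by apply: ereal_sup_ubound; exists x.
Qed.

Lemma prox_ratio (R : realType) d (psi : 'rV[R]_d -> \bar R) (lam l : R) :
  limsup_norm (fun x => enorm (prox psi lam x) / enorm x) = l%:E -> l < 1 ->
  exists k r, [/\ 0 < k < 1, 0 < r & forall x, r <= enorm x ->
    dotv (prox psi lam x) (prox psi lam x) <= k ^+ 2 * dotv x x].
Proof.
(* Strictly between [l] and 1; the [2^-1] makes [k] positive whatever the sign of [l], as [k] later
   serves as a Young weight. *)
move=> fl l1; pose k := Num.max 2^-1 ((l + 1) / 2).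
have lk : l < k by rewrite lt_max; apply/orP; right; lra.
have k0 : 0 < k by rewrite lt_max invr_gt0 ltr0n.
have k1 : k < 1 by rewrite gt_max; apply/andP; split; lra.
have [r0 r0P] := limsup_norm_lt fl lk.
exists k, (Num.max r0 1); split=> [||x]; [by rewrite k0 k1|by rewrite lt_max ltr01 orbT|].
rewrite ge_max => /andP[/r0P + x1].
have x0 : 0 < enorm x by rewrite (lt_le_trans _ x1).
rewrite ler_pdivrMr// => h.
rewrite -!enorm_sqr -exprMn ler_pXn2r// nnegrE ?enorm_ge0//.
by rewrite mulr_ge0 ?ltW.
Qed.

Lemma dotv_triangle (R : realType) d (u v : 'rV[R]_d) s : 0 < s ->
  dotv (u + v) (u + v) <= (1 + s) * dotv u u + (1 + s^-1) * dotv v v.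
Proof. by move=> s0; rewrite dotv_sqrD; have := dotv_amgm u v s0; lra. Qed.

Lemma dotv_convex (R : realType) d (u v : 'rV[R]_d) t : 0 <= t <= 1 ->
  dotv ((1 - t) *: u + t *: v) ((1 - t) *: u + t *: v) <=
  (1 - t) * dotv u u + t * dotv v v.
Proof.
move=> /andP[t0 t1]; rewrite dotv_sqrD !dotvZl !dotvZr.
have := dotv_amgm u v ltr01; rewrite invr1 !mul1r => h.
have : t * (1 - t) * (2 * dotv u v) <= t * (1 - t) * (dotv u u + dotv v v).
  by rewrite ler_wpM2l// mulr_ge0// subr_ge0.
lra.
Qed.

Section Chain.
Variables (R : realType) (d : nat) (psi : 'rV[R]_d -> \bar R) (lam h m k r : R).
Hypothesis psip : proper_fun psi.
Hypothesis psil : lsc psi.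
Hypothesis psic : convex_fun psi.
Hypothesis psim : forall x, (m%:E <= psi x)%E.
Hypothesis lam0 : 0 < lam.
Hypothesis h0 : 0 < h.
Hypothesis hlam : h <= 2 * lam.
Hypothesis k01 : 0 < k < 1.
Hypothesis r0 : 0 < r.
(* Opaque names: unfolding the definitions makes unification very slow. *)
Variables (env dens : 'rV[R]_d -> R) (prx mean : 'rV[R]_d -> 'rV[R]_d).
Variables (q acc : 'rV[R]_d -> 'rV[R]_d -> R) (Z : R).
Hypothesis moreauRE : moreauR psi lam = env.
Hypothesis prxE : prox psi lam = prx.
Hypothesis mala_meanE : mala_mean psi lam h = mean.
Hypothesis qM_E : qM psi lam h = q.
Hypothesis accept_E : accept psi lam h = acc.
Hypothesis ZlamE : Zlam psi lam = Z.
Hypothesis pi_densE : pi_dens psi lam = dens.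
Hypothesis proxk : forall x, r <= enorm x ->
  dotv (prx x) (prx x) <= k ^+ 2 * dotv x x.
Hypothesis inwards : converges_inwards psi lam h.
Variable mu : {sigma_finite_measure set (rowB R d) -> \bar R}.
Hypothesis muE : forall f : rowB R d -> \bar R, measurable_fun setT f ->
  (forall x, 0 <= f x)%E -> intRd f = (\int[mu]_x f x)%E.

Implicit Types x y : 'rV[R]_d.

Local Notation V x := (dotv x x).

(** * Contraction of the proposal mean and growth of the envelope *)

Let theta := h / (2 * lam).

Let theta01 : 0 < theta <= 1.
Proof.
by rewrite /theta divr_gt0 ?mulr_gt0//= ler_pdivrMr ?mulr_gt0// mul1r.
Qed.

Lemma meanE x : mean x = (1 - theta) *: x + theta *: prx x.
Proof.
rewrite -mala_meanE /mala_mean (env_grad psip psil psic psim lam0) prxE.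
by apply/rowP => i; rewrite !mxE /theta; field; rewrite gt_eqF.
Qed.

Let P0 := V (prx 0).

Let P0_ge0 : 0 <= P0. Proof. exact: dotv_ge0. Qed.

Lemma prox_growth x : V (prx x) <= 2 * V x + 2 * P0.
Proof.
have := prox_nonexp psip psil psic psim lam0 x 0; rewrite prxE subr0 => h1.
have := dotv_triangle (prx x - prx 0) (prx 0) ltr01.
rewrite subrK invr1 /P0; lra.
Qed.

Lemma mean_convex x : V (mean x) <= (1 - theta) * V x + theta * V (prx x).
Proof.
have /andP[t0 t1] := theta01.
by rewrite meanE; apply: dotv_convex; rewrite ltW.
Qed.

(** A crude bound valid at every point, for the region where no contraction is known and for the
    minorization. *)
Lemma mean_growth x : V (mean x) <= 3 * V x + 2 * P0.
Proof.
have /andP[t0 t1] := theta01.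
have := mean_convex x; have := prox_growth x.
have : 0 <= theta * V x by rewrite mulr_ge0 ?dotv_ge0// ltW.
have : theta * V (prx x) <= V (prx x) by rewrite ler_piMl// dotv_ge0.
lra.
Qed.

Let kappa := 1 - theta * (1 - k ^+ 2).

Let kappa01 : 0 <= kappa < 1.
Proof.
have /andP[t0 t1] := theta01; have /andP[k0 k1] := k01.
have k2 : 0 < 1 - k ^+ 2 by rewrite subr_gt0 expr_lt1// ltW.
have : 0 < theta * (1 - k ^+ 2) by rewrite mulr_gt0.
have : theta * (1 - k ^+ 2) <= 1 * (1 - k ^+ 2) by rewrite ler_wpM2r// ltW.
have := sqr_ge0 k.
by rewrite /kappa => ? ? ?; apply/andP; split; lra.
Qed.

Lemma mean_contract x : r <= enorm x -> V (mean x) <= kappa * V x.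
Proof.
move=> rx; have /andP[t0 t1] := theta01.
have := mean_convex x; have := ler_wpM2l (ltW t0) (proxk rx).
rewrite /kappa; lra.
Qed.

(* Outside a ball [prx x] stays in the ball of radius [k |x|], so the proximal
   penalty alone grows like [(1 - k)^2 |x|^2]. *)
Lemma env_growth x : m - (1 - k) ^+ 2 / (2 * lam) * r ^+ 2 +
  (1 - k) ^+ 2 / (2 * lam) * V x <= env x.
Proof.
have /andP[k0 k1] := k01.
have l2 : 0 < 2 * lam by rewrite mulr_gt0.
pose A := (1 - k) ^+ 2 / (2 * lam); rewrite -/A.
have A0 : 0 <= A by rewrite divr_ge0 ?sqr_ge0// ltW.
have env_m := env_ge psip psil psim lam0 x; rewrite prxE moreauRE in env_m.
have [rx|xr] := leP r (enorm x).
(* Young with weight [k], the equality case being [prx x = k x]; this is what produces the sharp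
   factor [(1 - k)^2]. *)
- have amgm := dotv_amgm x (prx x) k0.
  have : (1 - k) ^+ 2 * V x <= dotv (prx x - x) (prx x - x).
    rewrite dotv_sqrD dotvNr dotvNl dotvNr opprK (dotvC (prx x)).
    have := ler_wpM2l (_ : 0 <= k^-1 - 1) (proxk rx).
    rewrite subr_ge0 invf_ge1// (ltW k1) => /(_ isT).
    rewrite (_ : (k^-1 - 1) * (k ^+ 2 * _) = (k - k ^+ 2) * V x); last first.
      by field; rewrite gt_eqF.
    lra.
  rewrite -(ler_pM2r (_ : 0 < (2 * lam)^-1)) ?invr_gt0// mulrAC -/A.
  have : 0 <= A * r ^+ 2 by rewrite mulr_ge0// sqr_ge0.
  lra.
- have : A * V x <= A * r ^+ 2.
    rewrite ler_wpM2l// -enorm_sqr ler_pXn2r ?nnegrE ?enorm_ge0 ?ltW//.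
  have : 0 <= dotv (prx x - x) (prx x - x) / (2 * lam).
    by rewrite divr_ge0 ?dotv_ge0// ltW.
  lra.
Qed.

(** Tests the infimum with one fixed point of the domain of [psi]. This bounds the target density
    below by a Gaussian. *)
Lemma env_upper : exists b y0, m <= b /\
  forall x, env x <= b + (V y0 + V x) / lam.
Proof.
have [[y0 y0oo] psiNy] := psip.
have y0E : psi y0 = (fine (psi y0))%:E.
  by rewrite fineK// fin_numE gt_eqF ?lt_eqF// psiNy.
exists (fine (psi y0)), y0; split; first by rewrite -lee_fin -y0E.
move=> x; rewrite -moreauRE (le_trans (env_le psip psim lam0 x y0E))// lerD2l.
rewrite ler_pdivrMr ?mulr_gt0//.
have := dotv_triangle y0 (- x) ltr01.
rewrite invr1 dotvNl dotvNr opprK -/(V y0) -/(V x) => ?.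
rewrite (_ : _ / lam * _ = 2 * (V y0 + V x)); last by field; rewrite gt_eqF.
lra.
Qed.

Lemma measurable_env : measurable_fun setT (env : rowB R d -> R).
Proof.
by rewrite -moreauRE; apply: continuous_rowB_measurable; exact: env_continuous.
Qed.

Lemma measurable_mean_coord i :
  measurable_fun setT (fun x : rowB R d => mean x ord0 i).
Proof.
under eq_fun do rewrite meanE !mxE.
apply: measurable_funD; apply: measurable_funM => //.
  exact: coord_measurable.
apply: continuous_rowB_measurable.
by rewrite -prxE; exact: (prox_coord_continuous psip psil psic psim lam0).
Qed.

(** * The Gaussian proposal *)

Let s := (2 * h)^-1.
Let s0 : 0 < s. Proof. by rewrite invr_gt0 mulr_gt0. Qed.
Let N := (Num.sqrt (2 * pi * h))^-1 ^+ d.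

Let N0 : 0 < N.
Proof. by rewrite exprn_gt0// invr_gt0 sqrtr_gt0 !mulr_gt0// pi_gt0. Qed.

Let NE : N * Num.sqrt (pi / s) ^+ d = 1.
Proof.
have sq : Num.sqrt (2 * pi * h) != 0.
  by rewrite gt_eqF// sqrtr_gt0 !mulr_gt0// pi_gt0.
rewrite /N -exprMn (_ : pi / s = 2 * pi * h) ?mulVf ?expr1n//.
by rewrite /s invrK; ring.
Qed.

Lemma qME x y : q x y = N * expR (- (s * dotv (y - mean x) (y - mean x))).
Proof. by rewrite -qM_E /qM mala_meanE enorm_sqr /s mulNr (mulrC _^-1). Qed.

Lemma qM_gt0 x y : 0 < q x y.
Proof. by rewrite qME mulr_gt0 ?expR_gt0. Qed.

Let quad x y := dotv (y - mean x) (y - mean x).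

Let measurable_quad dT (T : measurableType dT) (f g : T -> rowB R d) :
  measurable_fun setT f -> measurable_fun setT g ->
  measurable_fun setT (fun t => quad (f t) (g t)).
Proof.
move=> mf mg.
have mi i : measurable_fun setT (fun t => (g t - mean (f t)) ord0 i).
  rewrite (_ : (fun t => _) = fun t => g t ord0 i - mean (f t) ord0 i).
    apply: measurable_funB; first exact: (measurableT_comp (coord_measurable i) mg).
    exact: (measurableT_comp (measurable_mean_coord i) mf).
  by apply/funext => t; rewrite [LHS]mxE [X in _ + X = _]mxE.
exact: measurable_dotv.
Qed.

Lemma measurable_qM dT (T : measurableType dT) (f g : T -> rowB R d) :
  measurable_fun setT f -> measurable_fun setT g ->
  measurable_fun setT (fun t => q (f t) (g t)).
Proof.
move=> mf mg.
rewrite (_ : (fun t => _) = fun t => N * expR (- (s * quad (f t) (g t)))); last first.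
  by apply/funext => t; rewrite qME.
apply: measurable_funM => //; apply: measurableT_comp => //.
apply: measurable_funN; apply: measurable_funM => //.
exact: measurable_quad.
Qed.

Lemma int_qM x : (\int[mu]_y (q x y)%:E)%E = 1%E.
Proof.
under eq_integral do rewrite qME EFinM.
rewrite ge0_integralZl_EFin//=.
- by rewrite (int_gauss muE _ s0) -EFinM NE.
- by apply/measurable_EFinP; exact: measurable_gauss.
- exact: ltW.
Qed.

Let G := N * (2 / s * Num.sqrt (pi / (s / 2)) ^+ d).

Let G0 : 0 <= G.
Proof.
apply: mulr_ge0; first exact: ltW.
by apply: mulr_ge0; [rewrite divr_ge0// ltW|rewrite exprn_ge0// sqrtr_ge0].
Qed.

Lemma int_qM_moment x :
  (\int[mu]_y (dotv (y - mean x) (y - mean x) * q x y)%:E <= G%:E)%E.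
Proof.
under eq_integral do rewrite qME mulrCA EFinM.
rewrite ge0_integralZl_EFin//=.
- by rewrite EFinM lee_wpmul2l ?lee_fin ?(ltW N0)// (int_gauss_moment muE).
- by move=> y _; rewrite lee_fin mulr_ge0 ?dotv_ge0 ?expR_ge0.
- apply/measurable_EFinP; apply: measurable_funM; first exact: measurable_dotvB.
  exact: measurable_gauss.
- exact: ltW.
Qed.

Lemma measurable_V : measurable_fun setT (fun x : rowB R d => V x).
Proof. by apply: measurable_dotv => i; exact: coord_measurable. Qed.

Let mq1 x : measurable_fun setT (q x : rowB R d -> R).
Proof. by apply: measurable_qM => //; exact: measurable_cst. Qed.

(** Young's inequality around the mean, rather than the exact variance identity, keeps every
    integrand nonnegative; the factor [1 + t] is affordable because the mean contracts strictly. *)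
Lemma int_qM_V x t : 0 < t ->
  (\int[mu]_y (q x y * V y)%:E <= ((1 + t) * V (mean x) + (1 + t^-1) * G)%:E)%E.
Proof.
move=> t0; have t1 : 0 <= 1 + t by lra.
have t2 : 0 <= 1 + t^-1 by rewrite addr_ge0// invr_ge0 ltW.
have q0 y : 0 <= q x y by exact: ltW (qM_gt0 x y).
have mD : measurable_fun setT
    (fun y : rowB R d => dotv (y - mean x) (y - mean x) * q x y).
  by apply: measurable_funM => //; exact: measurable_dotvB.
apply: (@le_trans _ _ (\int[mu]_y (((1 + t) * V (mean x) * q x y)%:E +
   ((1 + t^-1) * (dotv (y - mean x) (y - mean x) * q x y))%:E))%E).
  apply: ge0_le_integral => //.
  - by move=> y _; rewrite lee_fin mulr_ge0// dotv_ge0.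
  - by apply/measurable_EFinP; apply: measurable_funM => //; exact: measurable_V.
  - by apply: emeasurable_funD; apply/measurable_EFinP; apply: measurable_funM.
  - move=> y _; rewrite -EFinD lee_fin.
    have := dotv_triangle (mean x) (y - mean x) t0.
    rewrite addrC subrK => /(ler_wpM2r (q0 y)); rewrite -/(V _) (mulrC (q x y)).
    by rewrite mulrDl !mulrA.
rewrite ge0_integralD//=.
- under eq_integral do rewrite EFinM.
  rewrite ge0_integralZl_EFin//=; last 3 first.
  + by move=> y _; rewrite lee_fin.
  + exact/measurable_EFinP.
  + by rewrite mulr_ge0// dotv_ge0.
  rewrite int_qM mule1 EFinD leeD2l//.
  under eq_integral do rewrite EFinM.
  rewrite ge0_integralZl_EFin//=; last 2 first.
  + by move=> y _; rewrite lee_fin mulr_ge0// dotv_ge0.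
  + exact/measurable_EFinP.
  by rewrite EFinM lee_wpmul2l ?lee_fin// int_qM_moment.
- by move=> y _; rewrite lee_fin !mulr_ge0// dotv_ge0.
- by apply/measurable_EFinP; apply: measurable_funM.
- by move=> y _; rewrite lee_fin !mulr_ge0// dotv_ge0.
- by apply/measurable_EFinP; apply: measurable_funM.
Qed.

(** * The target density and its second moment *)

Let A := (1 - k) ^+ 2 / (2 * lam).
Let A0 : 0 < A.
Proof.
have /andP[k0 k1] := k01.
by apply: divr_gt0; [rewrite exprn_gt0// subr_gt0|rewrite mulr_gt0].
Qed.
Let B := expR (A * r ^+ 2 - m).

Lemma exp_env_le x : expR (- env x) <= B * expR (- (A * V x)).
Proof. by rewrite -expRD ler_expR; have := env_growth x; rewrite -/A; lra. Qed.

Lemma measurable_exp_env : measurable_fun setT (fun x : rowB R d => expR (- env x)).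
Proof.
by apply: measurableT_comp => //; apply: measurable_funN; exact: measurable_env.
Qed.

Let VB0 (y : 'rV[R]_d) : V y = dotv (y - 0) (y - 0).
Proof. by rewrite subr0. Qed.

(** Gaussian domination makes the integral finite, so [fine] in the normalising constant loses
    nothing. *)
Lemma int_exp_env : (\int[mu]_x (expR (- env x))%:E)%E = Z%:E.
Proof.
have muZ : intRd (fun x : rowB R d => (expR (- env x))%:E) =
    (\int[mu]_x (expR (- env x))%:E)%E.
  apply: muE; first by apply/measurable_EFinP; exact: measurable_exp_env.
  by move=> x; rewrite lee_fin expR_ge0.
rewrite -ZlamE /Zlam moreauRE muZ fineK// ge0_fin_numE; last first.
  by apply: integral_ge0 => x _; rewrite lee_fin expR_ge0.
apply: (@le_lt_trans _ _ (\int[mu]_x (B%:E * (expR (- (A * V x)))%:E))%E).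
  apply: ge0_le_integral => //.
  - by apply/measurable_EFinP; exact: measurable_exp_env.
  - apply: measurable_funeM; apply/measurable_EFinP.
    by under eq_fun do rewrite VB0; exact: measurable_gauss.
  - by move=> x _; rewrite -EFinM lee_fin exp_env_le.
under eq_integral do rewrite VB0.
rewrite ge0_integralZl_EFin//=; last 2 first.
- by apply/measurable_EFinP; exact: measurable_gauss.
- exact: expR_ge0.
by rewrite (int_gauss muE _ A0) -EFinM ltry.
Qed.

Lemma Z_gt0 : 0 < Z.
Proof.
have [b [y0 [_ yb]]] := env_upper.
have il : 0 < lam^-1 by rewrite invr_gt0.
pose C := expR (- (b + V y0 / lam)).
rewrite -lte_fin -int_exp_env.
apply: (@lt_le_trans _ _ (\int[mu]_x (C%:E * (expR (- (lam^-1 * V x)))%:E))%E).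
  under eq_integral do rewrite VB0.
  rewrite ge0_integralZl_EFin//=; last 2 first.
  - by apply/measurable_EFinP; exact: measurable_gauss.
  - exact: expR_ge0.
  rewrite (int_gauss muE _ il) -EFinM lte_fin mulr_gt0 ?expR_gt0//.
  by rewrite exprn_gt0// sqrtr_gt0 divr_gt0// pi_gt0.
apply: ge0_le_integral => //.
- by move=> x _; rewrite -EFinM lee_fin mulr_ge0 ?expR_ge0.
- apply: measurable_funeM; apply/measurable_EFinP.
  by under eq_fun do rewrite VB0; exact: measurable_gauss.
- by apply/measurable_EFinP; exact: measurable_exp_env.
- move=> x _; rewrite -EFinM lee_fin /C -expRD ler_expR.
  by have := yb x; rewrite mulrDl; lra.
Qed.

Lemma densE x : dens x = expR (- env x) / Z.
Proof. by rewrite -pi_densE /pi_dens moreauRE ZlamE. Qed.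

Lemma dens_gt0 x : 0 < dens x.
Proof. by rewrite densE divr_gt0 ?expR_gt0// Z_gt0. Qed.

Lemma measurable_dens : measurable_fun setT (dens : rowB R d -> R).
Proof.
rewrite (_ : dens = fun x => expR (- env x) / Z); last exact/funext/densE.
by apply: measurable_funM => //; exact: measurable_exp_env.
Qed.

Lemma int_dens : (\int[mu]_x (dens x)%:E)%E = 1%E.
Proof.
under eq_integral do rewrite densE mulrC EFinM.
rewrite ge0_integralZl_EFin//=; last 2 first.
- by apply/measurable_EFinP; exact: measurable_exp_env.
- by rewrite invr_ge0 ltW// Z_gt0.
by rewrite int_exp_env -EFinM mulVf// gt_eqF// Z_gt0.
Qed.

Lemma int_dens_V : (\int[mu]_x (dens x * V x)%:E < +oo)%E.
Proof.
have Z0 := Z_gt0; pose C := B / Z.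
have C0 : 0 <= C by rewrite divr_ge0 ?expR_ge0 ?ltW.
have mVg : measurable_fun setT
    (fun x : rowB R d => V x * expR (- (A * V x))).
  apply: measurable_funM; first exact: measurable_V.
  by under eq_fun do rewrite VB0; exact: measurable_gauss.
apply: (@le_lt_trans _ _
    (\int[mu]_x (C%:E * (V x * expR (- (A * V x)))%:E))%E).
  apply: ge0_le_integral => //.
  - by move=> x _; rewrite lee_fin mulr_ge0 ?dotv_ge0// ltW// dens_gt0.
  - apply/measurable_EFinP; apply: measurable_funM; first exact: measurable_dens.
    exact: measurable_V.
  - by apply: measurable_funeM; exact/measurable_EFinP.
  - move=> x _; rewrite -EFinM lee_fin mulrCA mulrC ler_wpM2l ?dotv_ge0//.
    by rewrite densE /C mulrAC ler_pM2r ?invr_gt0// exp_env_le.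
rewrite ge0_integralZl_EFin//=; last 2 first.
- by move=> x _; rewrite lee_fin mulr_ge0 ?dotv_ge0 ?expR_ge0.
- exact/measurable_EFinP.
under eq_integral do rewrite VB0.
apply: (@le_lt_trans _ _ (C%:E * (2 / A * Num.sqrt (pi / (A / 2)) ^+ d)%:E)%E).
  by rewrite lee_wpmul2l ?lee_fin// (int_gauss_moment muE).
by rewrite -EFinM ltry.
Qed.

(** * Acceptance rate and reversibility *)

Let a x y := acc x y * q x y.
Let p := (dens : rowB R d -> R).

Lemma acc_ratio x y :
  acc x y = Num.min 1 ((dens y * q y x) / (dens x * q x y)).
Proof. by rewrite -accept_E /accept pi_densE qM_E. Qed.

(** Normalising constants cancel in the ratio; a single exponential reduces measurability to that of
    [env] and [quad]. *)
Lemma accE x y :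
  acc x y = Num.min 1 (expR (env x - env y + s * quad x y - s * quad y x)).
Proof.
have Z0 := Z_gt0; have N00 := N0.
rewrite acc_ratio !densE !qME -/(quad x y) -/(quad y x).
move: (env x) (env y) (quad x y) (quad y x) Z Z0 N N00 => e1 e2 u v z z0 n n0.
congr Num.min; rewrite !expRD !expRN; field.
by rewrite !gt_eqF ?expR_gt0.
Qed.

Lemma measurable_accept dT (T : measurableType dT) (f g : T -> rowB R d) :
  measurable_fun setT f -> measurable_fun setT g ->
  measurable_fun setT (fun t => acc (f t) (g t)).
Proof.
move=> mf mg.
rewrite (_ : (fun t => _) = fun t => Num.min 1 (expR (env (f t) - env (g t) +
  s * quad (f t) (g t) - s * quad (g t) (f t)))); last first.
  by apply/funext => t; rewrite accE.
apply: measurable_minr => //.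
pose e t := env (f t) - env (g t) + s * quad (f t) (g t) - s * quad (g t) (f t).
suff me : measurable_fun setT e by exact: (measurableT_comp (@measurable_expR R) me).
apply: measurable_funB; last by apply: measurable_funM => //; exact: measurable_quad.
apply: measurable_funD; last by apply: measurable_funM => //; exact: measurable_quad.
apply: measurable_funB; first exact: (measurableT_comp measurable_env mf).
exact: (measurableT_comp measurable_env mg).
Qed.

Lemma acc01 x y : 0 <= acc x y <= 1.
Proof.
rewrite acc_ratio le_min ler01/= ge_min lexx/= andbT.
by rewrite divr_ge0// mulr_ge0// ltW ?dens_gt0 ?qM_gt0.
Qed.

Let a0 (x y : rowB R d) : 0 <= a x y.
Proof. by rewrite mulr_ge0//; [case/andP: (acc01 x y)|rewrite ltW ?qM_gt0]. Qed.

Let aq x y : a x y <= q x y.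
Proof. by rewrite ler_piMl//; [rewrite ltW ?qM_gt0|case/andP: (acc01 x y)]. Qed.

Let ma : measurable_fun setT (fun z : rowB R d * rowB R d => a z.1 z.2).
Proof. by apply: measurable_funM; [exact: measurable_accept|exact: measurable_qM]. Qed.

Let ma_slice x : measurable_fun setT (a x : rowB R d -> R).
Proof. exact: (measurable_kernel ma). Qed.

Let a1 (x : rowB R d) : (\int[mu]_y (a x y)%:E <= 1)%E.
Proof.
rewrite -(int_qM x); apply: ge0_le_integral => //.
- by move=> y _; rewrite lee_fin.
- by apply/measurable_EFinP; exact: ma_slice.
- by apply/measurable_EFinP; exact: mq1.
- by move=> y _; rewrite lee_fin.
Qed.

(** Both sides equal the minimum of [dens x * q x y] and [dens y * q y x], which is symmetric. *)
Let rev (x y : rowB R d) : p x * a x y = p y * a y x.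
Proof.
suff sym u v : dens u * (acc u v * q u v) = Num.min (dens u * q u v) (dens v * q v u).
  by rewrite /p /a !sym minC.
have D0 : 0 < dens u * q u v by rewrite mulr_gt0 ?dens_gt0 ?qM_gt0.
rewrite mulrCA acc_ratio minr_pMl ?ltW// mul1r divfK ?gt_eqF//.
Qed.

(* [q - a] is the density of the rejected proposals. *)
Let acc_mass_compl x : (1 - acc_mass mu a x)%:E = (\int[mu]_y (q x y - a x y)%:E)%E.
Proof.
have iq : mu.-integrable setT (EFin \o q x).
  apply: ge0_integrable => //; first by move=> y; rewrite ltW ?qM_gt0.
  by rewrite int_qM ltry.
have ia := integrable_kernel ma a0 a1 x.
rewrite integralB_EFin//= int_qM EFinB; congr (_ - _)%E.
exact: acc_massE.
Qed.

(** * Lyapunov drift *)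

Let As x := [set y | dens x * q x y <= dens y * q y x].

Let D x := symdiff (As x) (Iset x).

Let mD x : measurable (D x : set (rowB R d)).
Proof.
have mA : measurable (As x : set (rowB R d)).
  apply: measurable_ler_set; apply: measurable_funM => //.
    exact: measurable_dens.
  by apply: measurable_qM => //; exact: measurable_cst.
have mI : measurable (Iset x : set (rowB R d)).
  rewrite (_ : Iset x = [set y : rowB R d | V y <= V x]).
    by apply: measurable_ler_set => //; exact: measurable_V.
  apply/seteqP; split=> y /=; rewrite /Iset/= -!enorm_sqr;
    by rewrite ler_pXn2r// nnegrE enorm_ge0.
by apply: measurableU; exact: measurableD.
Qed.

Let Dq0 x y : 0 <= \1_(D x) y * q x y.
Proof. by apply: mulr_ge0; [rewrite indicE ler0n|rewrite ltW ?qM_gt0]. Qed.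

(* Where the acceptance rate is below 1 although [|y| <= |x|], the chain may
   stay at [x]; this only happens on [D x]. Elsewhere rejecting costs at most [V y]. *)
Let drift_pointwise x y :
  a x y * V y + (q x y - a x y) * V x <= q x y * V y + V x * (\1_(D x) y * q x y).
Proof.
have q0 : 0 <= q x y by rewrite ltW ?qM_gt0.
have V0 z : 0 <= V z by exact: dotv_ge0.
have ax := aq x y; have a00 := a0 x y.
have E0 : 0 <= V x * (\1_(D x) y * q x y).
  by apply: mulr_ge0; [exact: V0|exact: Dq0].
have [Axy|nAxy] := pselect (As x y).
  have D0 : 0 < dens x * q x y by rewrite mulr_gt0 ?dens_gt0 ?qM_gt0.
  have acc1 : acc x y = 1.
    by rewrite acc_ratio min_l// ler_pdivlMr// mul1r.
  by rewrite /a acc1 mul1r subrr mul0r addr0 lerDl.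
have [Ixy|nIxy] := pselect (Iset x y).
  have Vyx : V y <= V x by rewrite -!enorm_sqr ler_pXn2r// nnegrE enorm_ge0.
  rewrite indicE mem_set ?mul1r; last by right.
  have : a x y * V y <= q x y * V y by apply: ler_wpM2r; [exact: V0|exact: ax].
  have : 0 <= a x y * V x by apply: mulr_ge0; [exact: a00|exact: V0].
  lra.
have Vxy : V x <= V y.
  rewrite -!enorm_sqr ler_pXn2r// ?nnegrE ?enorm_ge0//.
  by rewrite ltW// ltNge; apply/negP.
have : (q x y - a x y) * V x <= (q x y - a x y) * V y.
  by rewrite ler_wpM2l// subr_ge0.
lra.
Qed.

Let eD x := (\int[mu]_y (\1_(D x) y * q x y)%:E)%E.

Let mDq x : measurable_fun setT (fun y : rowB R d => \1_(D x) y * q x y).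
Proof. by apply: measurable_funM => //; exact: measurable_indic. Qed.

Let eD_le1 x : (eD x <= 1)%E.
Proof.
rewrite -(int_qM x) /eD; apply: ge0_le_integral => //.
- by move=> y _; rewrite lee_fin.
- by apply/measurable_EFinP; exact: mDq.
- by apply/measurable_EFinP; exact: mq1.
- by move=> y _; rewrite lee_fin ler_piMl// ltW ?qM_gt0.
Qed.

(** Writing the rejection mass as the integral of [q - a] puts both terms under one integral, where
    the pointwise bound applies. *)
Let drift_integral x t : 0 < t ->
  (\int[mu]_y (a x y * V y)%:E + ((1 - acc_mass mu a x) * V x)%:E <=
   ((1 + t) * V (mean x) + (1 + t^-1) * G)%:E + (V x)%:E * eD x)%E.
Proof.
move=> t0; have V0 z : 0 <= V z by exact: dotv_ge0.
have q0 y : 0 <= q x y by rewrite ltW ?qM_gt0.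
have mV := measurable_V.
have qa0 y : 0 <= q x y - a x y by rewrite subr_ge0.
have mqa : measurable_fun setT (fun y : rowB R d => q x y - a x y).
  by apply: measurable_funB; [exact: mq1|exact: ma_slice].
have mqaE : measurable_fun setT (fun y : rowB R d => (q x y - a x y)%:E).
  by apply/measurable_EFinP; exact: mqa.
have mDE : measurable_fun setT (fun y : rowB R d => (\1_(D x) y * q x y)%:E).
  by apply/measurable_EFinP; exact: mDq.
have maVE : measurable_fun setT (fun y : rowB R d => (a x y * V y)%:E).
  by apply/measurable_EFinP; apply: measurable_funM; [exact: ma_slice|exact: mV].
have mqVE : measurable_fun setT (fun y : rowB R d => (q x y * V y)%:E).
  by apply/measurable_EFinP; apply: measurable_funM; [exact: mq1|exact: mV].
rewrite mulrC EFinM acc_mass_compl -ge0_integralZl_EFin//; last 2 first.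
- by move=> y _; rewrite lee_fin.
- exact: V0.
have aV0 y : 0 <= a x y * V y by apply: mulr_ge0; [exact: a0|exact: V0].
have qV0 y : 0 <= q x y * V y by apply: mulr_ge0; [exact: q0|exact: V0].
have Vqa0 y : 0 <= V x * (q x y - a x y) by apply: mulr_ge0; [exact: V0|exact: qa0].
have VD0 y : 0 <= V x * (\1_(D x) y * q x y).
  by apply: mulr_ge0; [exact: V0|exact: Dq0].
rewrite -ge0_integralD//; last 3 first.
- by move=> y _; rewrite lee_fin aV0.
- by move=> y _; rewrite -EFinM lee_fin Vqa0.
- by apply: measurable_funeM; exact: mqaE.
apply: (@le_trans _ _
    (\int[mu]_y ((q x y * V y)%:E + (V x)%:E * (\1_(D x) y * q x y)%:E))%E).
  apply: ge0_le_integral => //.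
  - by move=> y _; rewrite -EFinM -EFinD lee_fin addr_ge0.
  - by apply: emeasurable_funD; [exact: maVE|apply: measurable_funeM; exact: mqaE].
  - by apply: emeasurable_funD; [exact: mqVE|apply: measurable_funeM; exact: mDE].
  - move=> y _; rewrite -!EFinM -!EFinD lee_fin (mulrC (V x) (_ - _)).
    exact: drift_pointwise.
rewrite ge0_integralD//.
- rewrite ge0_integralZl_EFin//.
  + by rewrite leeD2r// int_qM_V.
  + by move=> y _; rewrite lee_fin Dq0.
  + exact: V0.
- by move=> y _; rewrite lee_fin qV0.
- by move=> y _; rewrite -EFinM lee_fin VD0.
- by apply: measurable_funeM; exact: mDE.
Qed.

Lemma mala_drift : exists g K, [/\ 0 <= g < 1, 0 <= K & forall x,
  (\int[mu]_y (a x y * V y)%:E + ((1 - acc_mass mu a x) * V x)%:E <=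
   (g * V x + K)%:E)%E].
Proof.
have /andP[ka0 ka1] := kappa01.
(* Used both as Young weight and as bound on the proposal mass of [D x]: [(1 + t) kappa + t <= kappa
   + 2 t = (1 + kappa) / 2]. *)
pose t := (1 - kappa) / 4.
have t0 : 0 < t by rewrite divr_gt0// subr_gt0.
have [r2 r2P] := inwards t0.
pose M := Num.max r (Num.max r2 0).
have M0 : 0 <= M by rewrite !le_max lexx !orbT.
have T0 : 0 <= (1 + t^-1) * G by rewrite mulr_ge0 ?G0// addr_ge0// invr_ge0 ltW.
(* Dominates the left side inside the ball of radius [M], where [mean_growth] replaces the
   contraction and the mass of [D x] is only known to be at most 1. *)
pose K := (1 + t) * (3 * M ^+ 2 + 2 * P0) + (1 + t^-1) * G + M ^+ 2.
have M20 := sqr_ge0 M.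
have K1 : 0 <= (1 + t) * (3 * M ^+ 2 + 2 * P0).
  by apply: mulr_ge0; [|have := P0_ge0]; lra.
exists ((1 + kappa) / 2), K; split; first by apply/andP; split; lra.
  by rewrite /K; lra.
move=> x; apply: (le_trans (drift_integral x t0)).
have V0 : 0 <= V x by exact: dotv_ge0.
have [Mx|xM] := leP M (enorm x).
- have rx : r <= enorm x by rewrite (le_trans _ Mx)// le_max lexx.
  have r2x : r2 <= enorm x by rewrite (le_trans _ Mx)// !le_max lexx !orbT.
  have eDt : (eD x <= t%:E)%E.
    have muD : intRd (fun y : rowB R d => (\1_(D x) y * q x y)%:E) = eD x.
      apply: muE; first by apply/measurable_EFinP; exact: mDq.
      by move=> y; rewrite lee_fin Dq0.
    by rewrite -muD; have := r2P _ r2x; rewrite /Aset pi_densE qM_E; exact.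
  apply: (@le_trans _ _ (((1 + t) * V (mean x) + (1 + t^-1) * G)%:E +
      (V x)%:E * t%:E)%E).
    by rewrite leeD2l// lee_wpmul2l// lee_fin.
  rewrite -EFinM -EFinD lee_fin.
  have : (1 + t) * V (mean x) <= (1 + t) * (kappa * V x).
    by rewrite ler_wpM2l ?mean_contract//; lra.
  have : t * (kappa * V x) <= t * V x.
    by apply: ler_wpM2l; [exact: ltW|apply: ler_piMl; [exact: V0|exact: ltW]].
  have tE : 4 * t = 1 - kappa by rewrite /t; lra.
  have : 4 * (t * V x) = (1 - kappa) * V x by rewrite mulrA tE.
  rewrite /K; lra.
- have VM : V x <= M ^+ 2.
    by rewrite -enorm_sqr ler_pXn2r ?nnegrE ?enorm_ge0// ltW.
  apply: (@le_trans _ _ (((1 + t) * V (mean x) + (1 + t^-1) * G)%:E +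
      (V x)%:E * 1)%E).
    by rewrite leeD2l// lee_wpmul2l ?eD_le1// lee_fin.
  rewrite mule1 -EFinD lee_fin.
  have : (1 + t) * V (mean x) <= (1 + t) * (3 * M ^+ 2 + 2 * P0).
    by rewrite ler_wpM2l//; [lra|have := mean_growth x; lra].
  have : 0 <= (1 + kappa) / 2 * V x by rewrite mulr_ge0// divr_ge0// addr_ge0.
  rewrite /K; lra.
Qed.

(** The accepted density is the minimum of [q x y] and [exp (env x - env y) * q y x]. For [V x <= L]
    both have Gaussian lower bounds in [y]: the first directly, the second because [env x >= m] and
    [env y] grows at most quadratically. *)
Lemma mala_minorization L : exists eps (w : rowB R d -> R),
  [/\ 0 < eps <= 1, measurable_fun setT w, forall x, 0 <= w x,
   (\int[mu]_x (w x)%:E)%E = 1%E &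
   forall x y, V x <= L -> eps * w y <= a x y].
Proof.
have [b [y0 [mb yb]]] := env_upper.
(* [3 / h] comes from [mean_growth] at [y] in the reverse proposal, [1 / lam] from the upper bound
   on [env y]; [E] below gathers all terms free of [y]. *)
pose S := 3 / h + lam^-1.
have S0 : 0 < S by rewrite addr_gt0 ?invr_gt0// divr_gt0.
pose I := Num.sqrt (pi / S) ^+ d.
have I0 : 0 < I by rewrite exprn_gt0// sqrtr_gt0 divr_gt0// pi_gt0.
pose E := (3 * `|L| + 2 * P0) / h + (b - m) + V y0 / lam.
pose eps := Num.min 1 (N * expR (- E) * I).
pose w (y : rowB R d) := I^-1 * expR (- (S * V y)).
have NEI : 0 < N * expR (- E) * I by rewrite !mulr_gt0 ?expR_gt0.
have mg : measurable_fun setT (fun y : rowB R d => expR (- (S * V y))).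
  by under eq_fun do rewrite VB0; exact: measurable_gauss.
exists eps, w; split.
- by rewrite lt_min ltr01 NEI ge_min lexx.
- exact: measurable_funM.
- by move=> y; rewrite mulr_ge0 ?expR_ge0// invr_ge0 ltW.
- under eq_integral do rewrite EFinM.
  rewrite ge0_integralZl_EFin//=; last 2 first.
  + exact/measurable_EFinP.
  + by rewrite invr_ge0 ltW.
  under eq_integral do rewrite VB0.
  by rewrite (int_gauss muE _ S0) -EFinM mulVf// gt_eqF.
move=> x y xL.
have V0 z : 0 <= V z by exact: dotv_ge0.
have VL : V x <= `|L| by rewrite (le_trans xL)// ler_norm.
have hI : 0 < h^-1 by rewrite invr_gt0.
have lI : 0 < lam^-1 by rewrite invr_gt0.
have wle : eps * w y <= N * expR (- E - S * V y).
  rewrite /w expRD (mulrA eps) (mulrA N) ler_wpM2r ?expR_ge0//.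
  by rewrite ler_pdivrMr// /eps ge_min lexx orbT.
apply: (le_trans wle).
have sq (u v : 'rV[R]_d) : s * dotv (u - v) (u - v) <= (V u + V v) / h.
  have := dotv_triangle u (- v) ltr01.
  rewrite invr1 dotvNl dotvNr opprK -/(V u) -/(V v) => uv.
  have sE : s = h^-1 / 2 by rewrite /s; field; rewrite gt_eqF.
  rewrite sE mulrAC ler_pdivrMr// mulrC -mulrA (mulrC _ h^-1).
  by rewrite [leRHS]mulrCA ler_pM2l//; lra.
have Vh0 (z : 'rV[R]_d) : 0 <= V z / h by apply: mulr_ge0; [exact: V0|exact: ltW].
have Vl0 (z : 'rV[R]_d) : 0 <= V z / lam by apply: mulr_ge0; [exact: V0|exact: ltW].
have p1 := Vl0 y0; have p2 := Vh0 (prx 0); have p3 := Vl0 y; have p4 := Vh0 y.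
have p5 : V x / h <= `|L| / h by rewrite ler_pM2r.
have p6 := Vh0 x.
rewrite -/P0 in p2.
have gx : V (mean x) / h <= (3 * V x + 2 * P0) / h.
  by rewrite ler_pM2r// mean_growth.
have gy : V (mean y) / h <= (3 * V y + 2 * P0) / h.
  by rewrite ler_pM2r// mean_growth.
have -> : a x y = Num.min (q x y) (expR (env x - env y) * q y x).
  have D0 : 0 < dens x * q x y by rewrite mulr_gt0 ?dens_gt0 ?qM_gt0.
  rewrite /a acc_ratio minr_pMl ?(ltW (qM_gt0 x y))// mul1r; congr Num.min.
  have Z0 := Z_gt0; have := qM_gt0 x y; rewrite !densE expRD !expRN.
  by move: (q x y) => qxy q0; field; rewrite !gt_eqF ?expR_gt0.
rewrite le_min !qME; apply/andP; split.
- rewrite ler_pM2l// ler_expR.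
  have := sq y (mean x); rewrite /E /S; lra.
- rewrite mulrCA ler_pM2l// -expRD ler_expR.
  have := sq x (mean y); have := yb y.
  have : m <= env x.
    have := env_ge psip psil psim lam0 x; rewrite prxE moreauRE.
    have : 0 <= dotv (prx x - x) (prx x - x) / (2 * lam).
      by rewrite divr_ge0 ?dotv_ge0// mulr_ge0// ltW.
    lra.
  rewrite /E /S; lra.
Qed.

(** The bridge from the iterated integrals of the statement to the abstract operator; values in
    [[0, 1]] keep both integrals finite. *)
Let mala_opE (f : rowB R d -> R) x :
  measurable_fun setT f -> (forall y, 0 <= f y <= 1) ->
  mala_op psi lam h (EFin \o f) x = (mh_op mu a f x)%:E.
Proof.
move=> mf f01; have f0 y : 0 <= f y by case/andP: (f01 y).
have e1 : intRd (fun y : rowB R d => ((acc x y * q x y)%:E * (EFin \o f) y)%E) =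
    (\int[mu]_y (a x y * f y))%:E.
  rewrite (int_kernelME ma a0 a1)//; apply: muE => [|y].
    by apply/measurable_EFinP; apply: measurable_funM => //; exact: ma_slice.
  by rewrite lee_fin; apply: mulr_ge0; [exact: a0|exact: f0].
have e2 : intRd (fun y : rowB R d => (acc x y * q x y)%:E) = (acc_mass mu a x)%:E.
  rewrite (acc_massE ma a0 a1); apply: muE => [|y].
    by apply/measurable_EFinP; exact: ma_slice.
  by rewrite lee_fin a0.
by rewrite /mala_op accept_E qM_E e1 e2 /mh_op EFinD EFinM EFinB.
Qed.

Theorem mala_geometrically_ergodic : geometrically_ergodic psi lam h.
Proof.
have [g [K [g01 K0 dr]]] := mala_drift.
pose L := (2 * K + 1) / (1 - g).
have KL : 2 * K < (1 - g) * L.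
  have /andP[_ g1] := g01.
  rewrite /L [ltRHS]mulrC divfK; first by rewrite ltrDl.
  by rewrite gt_eqF// subr_gt0.
have [eps [w [e01 mw w0 w1 small]]] := mala_minorization L.
have p0 (x : rowB R d) : 0 <= p x by rewrite ltW ?dens_gt0.
have V0 (x : rowB R d) : 0 <= V x by exact: dotv_ge0.
have [rho [M [rho01 ergo]]] := harris ma a0 a1 measurable_dens p0 int_dens rev
  measurable_V V0 int_dens_V g01 K0 dr mw w0 w1 e01 KL small.
(* The exceptional null set is empty: the bound holds from every starting point. *)
exists rho, M, set0; split=> //; split; [|split].
- exact: sigma_algebra0.
- rewrite /pi_meas pi_densE muE.
  + by apply: integral0_eq => x _; rewrite indicE in_set0 mul0r.
  + apply/measurable_EFinP; apply: measurable_funM; last exact: measurable_dens.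
    by apply: measurable_indic; exact: measurable0.
  + by move=> x; rewrite lee_fin mulr_ge0// p0.
move=> x _ n C mC.
have mC1 : measurable_fun setT (\1_C : rowB R d -> R) by exact: measurable_indic.
have C01 (y : rowB R d) : 0 <= (\1_C y : R) <= 1.
  by rewrite indicE; case: (_ \in _); rewrite ?lexx ?ler01.
have -> : mala_kernel_n psi lam h n x C = (iter n (mh_op mu a) \1_C x)%:E.
  rewrite /mala_kernel_n; elim: n x => // n IH x /=.
  have [mi i01] := iter_mh_op ma a0 a1 n mC1 C01.
  rewrite -(mala_opE _ mi i01); congr (mala_op _ _ _ _ _).
  by apply/funext => y; exact: IH.
have -> : pi_meas psi lam C = (\int[mu]_y (p y * \1_C y))%:E.
  rewrite /pi_meas pi_densE muE.
  - rewrite /Rintegral fineK.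
      by apply: eq_integral => y _; rewrite mulrC.
    apply: integrable_fin_num => //.
    apply: (integrable_densityM measurable_dens p0 int_dens) => // y.
    by rewrite ger0_norm; case/andP: (C01 y).
  - by apply/measurable_EFinP; apply: measurable_funM => //; exact: measurable_dens.
  - by move=> y; rewrite lee_fin mulr_ge0// p0.
by rewrite -EFinB /= lee_fin; exact: ergo.
Qed.

End Chain.

Unset Implicit Arguments.

Theorem theorem5 (R : realType) (d : nat) (psi : 'rV[R]_d -> \bar R)
    (lam h l : R) :
  proper_fun psi -> lsc psi -> convex_fun psi -> bounded_below psi ->
  (intRd (fun x => expeR (- psi x)%E) < +oo)%E ->
  0 < lam ->
  limsup_norm (fun x => enorm (prox psi lam x) / enorm x) = l%:E -> l < 1 ->
  0 < h ->
  converges_inwards psi lam h ->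
  h <= 2 * lam ->
  geometrically_ergodic psi lam h.
Proof.
move=> psip psil psic [m psim] _ lam0 fl l1 h0 inw hl.
have [mu muE] := intRd_measure R d.
have [k [r [k01 r0 proxk]]] := prox_ratio fl l1.
(* The seven [erefl] identify the opaque names of the section with the definitions they stand
   for. *)
by apply: (@mala_geometrically_ergodic R d psi lam h m k r psip psil psic psim
  lam0 h0 hl k01 r0 _ _ _ _ _ _ _ erefl erefl erefl erefl erefl erefl erefl
  proxk inw mu muE).
Qed.
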